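(* Let $(\mathcal{U},f,\mathfrak{I})$ be a regular lemniscate region and let $w(z)$ be an analytic function in $\mathcal{U}$. For $t\in\mathfrak{I}$ put $$L_w(t)=\int_{E_{\mathcal{U},f}(t)}|w(z)|^2\,|dz| .$$ Then $L_w\in C^{\infty}(\mathfrak{I})$. Moreover, for any $t\in\mathfrak{I}$ the sequence of derivatives $L_w^{(k)}(t)$, $k\ge 0$, forms a Hamburger moment sequence; that is, for any $t\in\mathfrak{I}$ and for all $p=0,1,2,\ldots$ the Hankel matrix $$\begin{pmatrix} L_w(t) & L_w'(t) & \ldots & L_w^{(p)}(t)\\ L_w'(t) & L_w''(t) & \ldots & L_w^{(p+1)}(t)\\ \vdots & \vdots & \ddots & \vdots\\ L_w^{(p)}(t) & L_w^{(p+1)}(t) & \ldots & L_w^{(2p)}(t)\end{pmatrix}$$ is non-negative definite. Moreover, for all $k\ge 0$ and all $t\in\mathfrak{I}$, $$L_w^{(k)}(t)=\langle w_{[j]};w_{[k-j]}\rangle_t:=\int_{E_{\mathcal{U},f}(t)}\mathrm{Re}\,\bigl(\overline{w_{[k-j]}(z)}\,w_{[j]}(z)\bigr)\,|dz|,\qquad 0\le j\le k,$$ where the integrals are independent of the choice of $j$.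
   Context: Let $f$ be an analytic function (on an open subset of $\mathbb{C}$) and, for real $t$, let $E_f(t)=\{z:\ln|f(z)|=t\}$. A lemniscate region of $f$ is a triple $(\mathcal{U},f,\mathfrak{I})$, where $\mathfrak{I}=(a,b)$ is an open interval ($-\infty\le a<b\le+\infty$), $\mathcal{U}$ is a connected component of the set $\{z: a<\ln|f(z)|<b\}$, and for every $t\in\mathfrak{I}$ the set $E_{\mathcal{U},f}(t):=E_f(t)\cap\mathcal{U}$ is compact; this is understood in the sense that the map $\ln|f|:\mathcal{U}\to\mathfrak{I}$ is proper. The lemniscate region is called regular if $f(z)f'(z)\neq0$ for all $z\in\mathcal{U}$. $|dz|$ denotes integration with respect to arc length. For $w$ analytic in $\mathcal{U}$ put $g=f/f'$ and $G_f(w)=2gw'+g'w$; define the iterates $w_{[0]}=w$, $w_{[k]}=G_f^{k}(w)$ for $k\ge1$. *)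

(* Defs.v *)
From HB Require Import structures.
From mathcomp Require Import all_boot all_order all_algebra.
From mathcomp Require Import all_classical all_reals all_analysis.
From mathcomp Require Import complex.

Set Implicit Arguments.
Unset Strict Implicit.
Unset Printing Implicit Defensive.
Import Order.TTheory GRing.Theory Num.Theory.
Import numFieldNormedType.Exports.

Local Open Scope ring_scope.
Local Open Scope classical_set_scope.

(* The complex numbers over [R], typed as a [numClosedFieldType] so that the
   generic topology, norm and derivative of numeric fields apply; in particular
   [derive1 f] is the complex derivative of [f : C R -> C R]. *)
Definition C (R : realType) : numClosedFieldType := R[i].

(* The norm [`|z|] of [C R] is valued in [C R]; this is the real modulus. *)
Definition cabs (R : realType) (z : C R) : R := Normc.normc z.

Section arc_length.
Context (R : realType).
Local Open Scope ereal_scope.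

(* [0] is adjoined so that the empty set has diameter [0] and not [-oo]. *)
Definition diameter (A : set (C R)) : \bar R :=
  ereal_sup (0 |` [set (cabs (p.1 - p.2))%:E | p in A `*` A]).

Definition fine_cover (delta : R) (A : set (C R)) : set (set (C R))^nat :=
  [set F | A `<=` \bigcup_k F k /\ forall k, diameter (F k) <= delta%:E].

Definition hausdorff1_pre (delta : R) (A : set (C R)) : \bar R :=
  ereal_inf [set \sum_(k <oo) diameter (F k) | F in fine_cover delta A].

(* One-dimensional Hausdorff outer measure; in dimension one the normalizing
   constant is [1], so that on curves it is the length. *)
Definition hausdorff1 (A : set (C R)) : \bar R :=
  ereal_sup [set hausdorff1_pre delta A | delta in [set d | (0 < d)%R]].

Lemma diameter_ge0 A : 0 <= diameter A.
Proof. by apply: ereal_sup_ubound; left. Qed.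

Lemma diameter0 : diameter set0 = 0.
Proof.
apply/eqP; rewrite eq_le diameter_ge0 andbT.
by apply: ge_ereal_sup => x [->//|[p [[]]]].
Qed.

Lemma hausdorff1_pre_ge0 delta A : 0 <= hausdorff1_pre delta A.
Proof.
apply: le_ereal_inf_tmp => _ [F _ <-].
by apply: nneseries_ge0 => *; exact: diameter_ge0.
Qed.

Lemma hausdorff1_pre0 delta : (0 < delta)%R -> hausdorff1_pre delta set0 = 0.
Proof.
move=> d0; apply/eqP; rewrite eq_le hausdorff1_pre_ge0 andbT.
apply: ereal_inf_lbound; exists (fun=> set0).
  by split=> // k; rewrite diameter0 lee_fin ltW.
by apply: eseries0 => *; rewrite diameter0.
Qed.

Lemma le_hausdorff1_pre delta :
  {homo hausdorff1_pre delta : A B / A `<=` B >-> A <= B}.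
Proof.
move=> A B AB; apply/ereal_inf_le_tmp => x [F [BF dF]] <-.
by exists F => //; split => //; exact: subset_trans AB BF.
Qed.

Lemma hausdorff1_pre_sigma_subadditive delta :
  sigma_subadditive (hausdorff1_pre delta).
Proof.
move=> A; have [[i ioo]|] := pselect (exists i, hausdorff1_pre delta (A i) = +oo).
  rewrite (eseries_pinfty _ _ ioo) ?leey// => n _.
  by rewrite -ltNye (lt_le_trans _ (hausdorff1_pre_ge0 _ _)).
rewrite -forallNE => Aoo.
suff add2e (e : {posnum R}) : hausdorff1_pre delta (\bigcup_n A n) <=
    \sum_(i <oo) hausdorff1_pre delta (A i) + e%:num%:E.
  by apply/lee_addgt0Pr => _/posnumP[].
rewrite (le_trans _ (epsilon_trick _ _ _))//; last first.
  by move=> n; exact: hausdorff1_pre_ge0.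
pose P n (B : (set (C R))^nat) := fine_cover delta (A n) B /\
  \sum_(k <oo) diameter (B k) <=
    hausdorff1_pre delta (A n) + (e%:num / (2 ^ n.+1)%:R)%:E.
have [G PG] : {G : ((set (C R))^nat)^nat & forall n, P n (G n)}.
  apply: (@choice _ _ P) => n; rewrite /P /hausdorff1_pre.
  set S := (X in ereal_inf X); move infS : (ereal_inf S) => iS.
  case: iS infS => [r Sr|Soo|Soo].
  - have en1 : (0 < e%:num / (2 ^ n.+1)%:R)%R by [].
    have /(lb_ereal_inf_adherent en1) : ereal_inf S \is a fin_num by rewrite Sr.
    move=> [x [B AnB muBx] xS].
    by exists B; split => //; rewrite muBx -Sr; exact/ltW.
  - by have := Aoo n; rewrite /hausdorff1_pre -/S Soo.
  - have := hausdorff1_pre_ge0 delta (A n).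
    by rewrite /hausdorff1_pre -/S Soo.
have muG_ge0 x : 0 <= (diameter \o uncurry G) x by exact: diameter_ge0.
apply: (@le_trans _ _ (\esum_(i in setT) (diameter \o uncurry G) i)).
  rewrite /hausdorff1_pre; apply: ereal_inf_lbound => /=.
  have /card_esym/ppcard_eqP[f] := card_nat2.
  exists (uncurry G \o f).
    split => [t [i _]|i]; last first.
      by rewrite /= /uncurry; case: (f i) => a b; exact: (PG a).1.2.
    move=> /((PG i).1.1) [j _ ?]; exists (f^-1%FUN (i, j)) => //=.
    by rewrite invK ?inE.
  rewrite -(esum_pred_image (diameter \o uncurry G) _ xpredT) ?[fun=> _]set_true//.
  by rewrite image_eq.
rewrite (_ : esum _ _ = \sum_(i <oo) \sum_(j <oo ) diameter (G i j)); last first.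
  pose J : nat -> set (nat * nat) := fun i => [set (i, j) | j in setT].
  rewrite (_ : setT = \bigcup_k J k); last first.
    by rewrite predeqE => -[a b]; split => // _; exists a => //; exists b.
  rewrite esum_bigcupT /=; last 2 first.
    - apply/trivIsetP => i j _ _ ij.
      rewrite predeqE => -[n m] /=; split => //= -[] [_] _ [<-{n} _].
      by move=> [m' _] [] /esym/eqP; rewrite (negbTE ij).
    - by move=> /= [n m]; exact: diameter_ge0.
  rewrite -(image_id [set: nat]) -fun_true esum_pred_image//; last first.
    by move=> n _; apply: esum_ge0 => m _; exact: diameter_ge0.
  apply: eq_eseriesr => /= j _.
  rewrite -(esum_pred_image (diameter \o uncurry G) (pair j) predT)/=; first last.
  - by move=> ? ? _ _; exact: (@can_inj _ _ _ snd).
  - by move=> n _; exact: diameter_ge0.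
  by congr esum; rewrite predeqE => -[a b]; split; move=> [i _ <-]; exists i.
apply: lee_lim.
- apply: is_cvg_nneseries => n *.
  by apply: nneseries_ge0 => m _ _; exact: diameter_ge0.
- apply: is_cvg_nneseries => n *; apply: adde_ge0 => //.
  exact: hausdorff1_pre_ge0.
- by near=> n; apply: lee_sum => i _; exact: (PG i).2.
Unshelve. all: by end_near. Qed.

Lemma hausdorff1_ge_pre delta A :
  (0 < delta)%R -> hausdorff1_pre delta A <= hausdorff1 A.
Proof. by move=> d0; apply: ereal_sup_ubound; exists delta. Qed.

Lemma hausdorff1_ge0 A : 0 <= hausdorff1 A.
Proof.
exact: (le_trans (hausdorff1_pre_ge0 1 A) (hausdorff1_ge_pre A (@ltr01 R))).
Qed.

Lemma hausdorff1_set0 : hausdorff1 set0 = 0.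
Proof.
apply/eqP; rewrite eq_le hausdorff1_ge0 andbT.
by apply: ge_ereal_sup => _ [d d0 <-]; rewrite hausdorff1_pre0.
Qed.

Lemma le_hausdorff1 : {homo hausdorff1 : A B / A `<=` B >-> A <= B}.
Proof.
move=> A B AB; apply: ge_ereal_sup => _ [d d0 <-].
exact: (le_trans (le_hausdorff1_pre _ AB) (hausdorff1_ge_pre _ d0)).
Qed.

Lemma hausdorff1_sigma_subadditive : sigma_subadditive hausdorff1.
Proof.
move=> A; apply: ge_ereal_sup => _ [d d0 <-].
apply: (le_trans (hausdorff1_pre_sigma_subadditive d A)).
apply: lee_nneseries => n *; first exact: hausdorff1_pre_ge0.
exact: hausdorff1_ge_pre.
Qed.

HB.instance Definition _ := isOuterMeasure.Build R (C R) hausdorff1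
  hausdorff1_set0 hausdorff1_ge0 le_hausdorff1 hausdorff1_sigma_subadditive.

Definition hausdorff1_outer : {outer_measure set (C R) -> \bar R} := hausdorff1.

(* Arc length [|dz|] on subsets of the plane: the one-dimensional Hausdorff
   measure on its Caratheodory-measurable sets. *)
Definition arc_length :
    {measure set (caratheodory_type hausdorff1_outer) -> \bar R} :=
  hausdorff1_outer.

End arc_length.

Section lemniscate.
Context (R : realType).

(* Analytic: locally the sum of a convergent power series. *)
Definition analytic_at (f : C R -> C R) (z0 : C R) : Prop :=
  exists c : nat -> C R, \forall z \near z0,
    [series c k * (z - z0) ^+ k]_k @ \oo --> f z.

Definition analytic_on (D : set (C R)) (f : C R -> C R) : Prop :=
  forall z, D z -> analytic_at f z.

(* [ln |f z|], equal to [-oo] at the zeros of [f]. *)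
Definition ln_abs (f : C R -> C R) (z : C R) : \bar R := lne (cabs (f z))%:E.

Definition ln_interval (a b : \bar R) : set R :=
  [set t | (a < t%:E < b)%E].

(* [Omega] is the open set on which [f] is given; the values outside [Omega] of
   the total function [f] play no role. *)
Definition ln_band (Omega : set (C R)) (f : C R -> C R) (a b : \bar R) :
    set (C R) :=
  [set z | Omega z /\ (a < ln_abs f z < b)%E].

Definition level_set (U : set (C R)) (f : C R -> C R) (t : R) : set (C R) :=
  U `&` [set z | ln_abs f z = t%:E].

Record lemniscate_region (Omega U : set (C R)) (f : C R -> C R)
    (a b : \bar R) : Prop := LemniscateRegion {
  lemniscate_domain_open : open Omega ;
  lemniscate_analytic : analytic_on Omega f ;
  lemniscate_interval : (a < b)%E ;
  lemniscate_component : exists2 z, ln_band Omega f a b z &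
    U = connected_component (ln_band Omega f a b) z ;
  (* properness of [ln |f| : U -> (a, b)] *)
  lemniscate_proper : forall K : set R, compact K -> K `<=` ln_interval a b ->
    compact (\bigcup_(t in K) level_set U f t) }.

Definition regular_lemniscate_region (Omega U : set (C R)) (f : C R -> C R)
    (a b : \bar R) : Prop :=
  lemniscate_region Omega U f a b /\ forall z, U z -> f z * derive1 f z != 0.

Definition G_op (f w : C R -> C R) : C R -> C R :=
  let g z := f z / derive1 f z in
  fun z => 2 * g z * derive1 w z + derive1 g z * w z.

Definition G_iter (f w : C R -> C R) (k : nat) : C R -> C R :=
  iter k (G_op f) w.

Definition L_fun (U : set (C R)) (f w : C R -> C R) (t : R) : R :=
  \int[arc_length R]_(z in level_set U f t) (cabs (w z) ^+ 2).

(* The extended-real integral is used, so that equating it to a real number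
   also asserts that it is finite. *)
Definition level_inner (U : set (C R)) (f : C R -> C R) (t : R)
    (u v : C R -> C R) : \bar R :=
  (\int[arc_length R]_(z in level_set U f t) (complex.Re ((v z)^* * u z))%:E)%E.

Definition nonneg_definite (n : nat) (A : 'M[R]_n) : Prop :=
  A^T = A /\ forall x : 'cV[R]_n, 0 <= (x^T *m A *m x) 0 0.

Definition hankel (s : nat -> R) (p : nat) : 'M[R]_p.+1 :=
  \matrix_(i < p.+1, j < p.+1) s (i + j)%N.

Definition hamburger_moment_sequence (s : nat -> R) : Prop :=
  forall p, nonneg_definite (hankel s p).

(* [C^oo] on an open set [I]: every iterated derivative is differentiable. *)
Definition smooth_on (I : set R) (h : R -> R) : Prop :=
  forall k t, I t -> derivable (derive1n k h) t 1.

End lemniscate.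

(* Main.v *)
Require Import Defs.
From mathcomp Require Import all_boot all_order all_algebra.
From mathcomp Require Import all_classical all_reals all_analysis.
From mathcomp Require Import complex.
From mathcomp Require Import ring lra.
Set Implicit Arguments.
Unset Strict Implicit.
Unset Printing Implicit Defensive.
Import Order.TTheory GRing.Theory Num.Theory.
Import numFieldNormedType.Exports.
Local Open Scope ring_scope.
Local Open Scope classical_set_scope.

(** Write [g = f / f'].  A branch of [log f] is a local coordinate on the region
    [U], in which [t = ln |f|] is the real part, the level curve of [t] is a union
    of vertical segments, and [|dz| = |g| ds] along it, where [s] is the imaginary
    part, that is, the argument of [f].  Put [h_w = w * sqrt g], for a local branch
    of the root.  Then [|w|^2 |dz| = |h_w|^2 ds], and the operator
    [G w = 2 g w' + g' w] satisfies [h_(G w) = 2 h_w'], the derivative being taken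
    with respect to [log f].  So for holomorphic [u] and [v]
    - the derivative in [t] of [Re (h_u * conj h_v)] is half of
      [Re (h_(G u) * conj h_v) + Re (h_u * conj h_(G v))], and
    - the derivative in [s] of [Im (h_u * conj h_v)] is half of
      [Re (h_(G u) * conj h_v) - Re (h_u * conj h_(G v))].
    The level curves are closed, hence the second expression integrates to zero:
    [<G u; v> = <u; G v>] for the pairing of the statement.  Therefore both halves
    of the first one are equal after integration, and the derivative of [<u; v>] is
    [<G u; v> = <u; G v>].  All the assertions follow by iteration; the Hankel
    form of [L] at a vector [x] is the integral of [|sum_i x_i w_[i]|^2].

    No global structure of the level curves is used.  The map [f] is a proper
    local biholomorphism, so the points of [U] over the values of [f] close to a
    given one form finitely many sheets ([local_inverse], [local_sheets]).  The sum
    of a function over the fiber of [f] above [exp (t + i s)] is then, locally in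
    [(t, s)], a finite sum over the sheets; it is smooth, and it has period [2 pi]
    in [s] because [exp (t + i s)] has, which replaces the fact that the curves
    close up.  An integral over the level curve of [t] is the integral over
    [0 <= s <= 2 pi] of such a fiberwise sum ([level_integral]): the part of the
    integral carried by the angles less than [y] has the fiberwise sum as derivative
    in [y], because a short arc has nearly the length of its chord
    ([hausdorff1_short_arc]).  The upper estimate of the length comes from a
    subdivision of the arc, the lower one from its projection to the tangent.
    That the sets in question are measurable for the Hausdorff measure is
    Caratheodory's criterion ([closed_hausdorff1_measurable]).  The derivative in
    [t] passes under the integral over [s] ([level_pairing_derive_flow]), and the
    integral over [s] of a derivative in [s] vanishes by periodicity
    ([level_flow_angle]). *)

(** * Moduli and topology of the complex plane *)

Section Modulus.
Context {R : realType}.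
Implicit Types (z w : C R) (x y : R).

Definition toC x : C R := x%:C%C.

Lemma normCE z : `|z| = toC (cabs z). Proof. by []. Qed.

Lemma complex_ext z w : complex.Re z = complex.Re w ->
  complex.Im z = complex.Im w -> z = w.
Proof. by case: z => a b; case: w => c d /= -> ->. Qed.

Lemma ReD z w : complex.Re (z + w) = complex.Re z + complex.Re w.
Proof. by case: z; case: w. Qed.
Lemma ImD z w : complex.Im (z + w) = complex.Im z + complex.Im w.
Proof. by case: z; case: w. Qed.
Lemma ReN z : complex.Re (- z) = - complex.Re z.
Proof. by case: z. Qed.
Lemma ImN z : complex.Im (- z) = - complex.Im z.
Proof. by case: z. Qed.
Lemma ReM z w : complex.Re (z * w) =
  complex.Re z * complex.Re w - complex.Im z * complex.Im w.
Proof. by case: z; case: w. Qed.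
Lemma ImM z w : complex.Im (z * w) =
  complex.Re z * complex.Im w + complex.Im z * complex.Re w.
Proof. by case: z; case: w. Qed.
Lemma ReJ z : complex.Re z^* = complex.Re z. Proof. by case: z. Qed.
Lemma ImJ z : complex.Im z^* = - complex.Im z. Proof. by case: z. Qed.
Definition ReImE := (ReD, ImD, ReN, ImN, ReM, ImM, ReJ, ImJ).

Lemma toCD x y : toC (x + y) = toC x + toC y. Proof. exact: rmorphD. Qed.
Lemma toCN x : toC (- x) = - toC x. Proof. exact: rmorphN. Qed.
Lemma cabs_ge0 z : 0 <= cabs z.
Proof. by case: z => a b; exact: sqrtr_ge0. Qed.

Lemma cabs0 : cabs (0 : C R) = 0. Proof. exact: Normc.normc0. Qed.

Lemma cabs_eq0 z : (cabs z == 0) = (z == 0).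
Proof.
by apply/eqP/eqP => [|->]; [exact: Normc.eq0_normc|exact: cabs0].
Qed.

Lemma cabs_gt0 z : (0 < cabs z) = (z != 0).
Proof. by rewrite lt_def cabs_ge0 andbT cabs_eq0. Qed.

Lemma cabsM z w : cabs (z * w) = cabs z * cabs w.
Proof. exact: Normc.normcM. Qed.

Lemma cabsV z : cabs z^-1 = (cabs z)^-1.
Proof. exact: Normc.normcV. Qed.

Lemma cabsN z : cabs (- z) = cabs z.
Proof. by case: z => a b; rewrite /cabs /= !sqrrN. Qed.

Lemma cabsB z w : cabs (z - w) = cabs (w - z).
Proof. by rewrite -cabsN opprB. Qed.

Lemma cabs_toC x : cabs (toC x) = `|x|.
Proof. by rewrite /cabs /= expr0n/= addr0 sqrtr_sqr. Qed.

Lemma cabs1 : cabs (1 : C R) = 1. Proof. exact: Normc.normc1. Qed.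

Lemma cabsX z n : cabs (z ^+ n) = cabs z ^+ n.
Proof. by elim: n => [|n IH]; rewrite ?cabs1// !exprS cabsM IH. Qed.

Lemma cabsJ z : cabs z^* = cabs z.
Proof. by case: z => a b; rewrite /cabs /= sqrrN. Qed.

Lemma cabs_sqr z : cabs z ^+ 2 = complex.Re z ^+ 2 + complex.Im z ^+ 2.
Proof. by case: z => a b; rewrite sqr_sqrtr ?addr_ge0 ?sqr_ge0. Qed.

Lemma cabsD z w : cabs (z + w) <= cabs z + cabs w.
Proof. by rewrite -lecR rmorphD/=; exact: (@ler_normD _ (R[i])). Qed.

Lemma cabs_sub z w u : cabs (z - w) <= cabs (z - u) + cabs (u - w).
Proof. by rewrite -[z - w](subrKA u) cabsD. Qed.

Lemma cabs_lip z w : `|cabs z - cabs w| <= cabs (z - w).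
Proof.
have := cabsD (z - w) w; have := cabsD (w - z) z.
rewrite !subrK [cabs (w - z)]cabsB => h1 h2.
by rewrite ler_norml; apply/andP; split; lra.
Qed.

Lemma Re_le_cabs z : `|complex.Re z| <= cabs z.
Proof.
by rewrite -[leRHS]ger0_norm ?cabs_ge0// -ler_sqr ?nnegrE// !real_normK ?num_real//
  cabs_sqr lerDl sqr_ge0.
Qed.

Lemma Im_le_cabs z : `|complex.Im z| <= cabs z.
Proof.
by rewrite -[leRHS]ger0_norm ?cabs_ge0// -ler_sqr ?nnegrE// !real_normK ?num_real//
  cabs_sqr lerDr sqr_ge0.
Qed.

Lemma cabs_le_ReIm z : cabs z <= `|complex.Re z| + `|complex.Im z|.
Proof.
rewrite -ler_sqr ?nnegrE ?addr_ge0 ?cabs_ge0// cabs_sqr sqrrD.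
by rewrite !real_normK ?num_real// addrAC lerDl mulrn_wge0// mulr_ge0.
Qed.

End Modulus.

Section Plane_topology.
Context {R : realType}.
Implicit Types (z w : C R).

Lemma nbhsCP z (A : set (C R)) :
  nbhs z A <-> exists2 e : R, 0 < e & forall y, cabs (y - z) < e -> A y.
Proof.
split=> [/nbhs_normP[e e0 eA]|[e e0 eA]].
  have [Ee Ie] : e = toC (complex.Re e) /\ 0 < complex.Re e.
    move: e0; rewrite /= ltcE => /andP[/eqP Ie Re]; split=> //.
    exact: complex_ext.
  exists (complex.Re e) => // y ye; apply: eA.
  by rewrite /ball_ /= Ee normCE ltcR cabsB.
apply/nbhs_normP; exists (toC e); first by rewrite /= ltcR.
by move=> y; rewrite /ball_/= normCE ltcR cabsB => /eA.
Qed.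

Lemma near_cabs z (e : R) : 0 < e -> \forall y \near z, cabs (y - z) < e.
Proof. by move=> e0; apply/nbhsCP; exists e. Qed.

Lemma cvgCP {T : Type} (F : set_system T) {FF : Filter F} (g : T -> C R) (l : C R) :
  g @ F --> l <-> forall e : R, 0 < e -> \forall x \near F, cabs (g x - l) < e.
Proof.
split=> [gl e e0|H A /nbhsCP[e e0 eA]].
  exact: (gl _ (near_cabs l e0)).
by apply: filterS (H e e0) => x; exact: eA.
Qed.

Lemma cvgRP {T : Type} (F : set_system T) {FF : Filter F} (g : T -> R) l :
  g @ F --> l <-> forall e : R, 0 < e -> \forall x \near F, `|g x - l| < e.
Proof.
by split=> [/cvgrPdistC_lt//|gl]; apply/cvgrPdistC_lt.
Qed.

Lemma cabs_continuous : continuous (@cabs R : C R -> R).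
Proof.
move=> z; apply/(cvgRP (F := nbhs z)) => e e0; near=> y.
by rewrite (le_lt_trans (cabs_lip _ _))//; near: y; exact: near_cabs.
Unshelve. all: by end_near. Qed.

Lemma Re_continuous : continuous (@complex.Re R : C R -> R).
Proof.
move=> z; apply/(cvgRP (F := nbhs z)) => e e0; near=> y.
by rewrite -ReN -ReD (le_lt_trans (Re_le_cabs _))//; near: y; exact: near_cabs.
Unshelve. all: by end_near. Qed.

Lemma Im_continuous : continuous (@complex.Im R : C R -> R).
Proof.
move=> z; apply/(cvgRP (F := nbhs z)) => e e0; near=> y.
by rewrite -ImN -ImD (le_lt_trans (Im_le_cabs _))//; near: y; exact: near_cabs.
Unshelve. all: by end_near. Qed.

Lemma cvg_ReIm {T : Type} (F : set_system T) {FF : Filter F} (g : T -> C R) (l : C R) :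
  complex.Re (g x) @[x --> F] --> complex.Re l ->
  complex.Im (g x) @[x --> F] --> complex.Im l -> g @ F --> l.
Proof.
move=> /cvgRP gr /cvgRP gi; apply/cvgCP => e e0.
have e2 : 0 < e / 2 by rewrite divr_gt0.
near=> x.
rewrite (le_lt_trans (cabs_le_ReIm _))// (splitr e) ltrD// !ReImE.
  by near: x; exact: gr.
by near: x; exact: gi.
Unshelve. all: by end_near. Qed.

Lemma toC_continuous : continuous (@toC R).
Proof.
by move=> x; apply: cvg_ReIm => /=; [exact: cvg_id|exact: cvg_cst].
Qed.

(** Segments are connected, so a ball inside an open set lies in a single
    component of it. *)
Lemma open_connected_component (A : set (C R)) z :
  open A -> open (connected_component A z).
Proof.
rewrite !openE => oA y Azy.
have /oA/nbhsCP[e e0 eA] := connected_component_sub Azy.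
apply/nbhsCP; exists e => // x xe.
apply: connected_component_trans Azy _.
pose h (s : R) := y + toC s * (x - y).
have hc : continuous h.
  move=> s; apply: cvgD; first exact: cvg_cst.
  by apply: cvgM; [exact: toC_continuous|exact: cvg_cst].
exists (h @` `[0, 1]); last by exists 1; rewrite /= ?in_itv/= ?ler01 ?lexx// /h mul1r subrKC.
split.
- by exists 0; rewrite /= ?in_itv/= ?ler01 ?lexx// /h mul0r addr0.
- move=> _ [s + <-]; rewrite /= in_itv/= => /andP[s0 s1]; apply: eA.
  rewrite /h addrC addKr cabsM cabs_toC ger0_norm//.
  by apply: le_lt_trans xe; rewrite ler_piMl ?cabs_ge0.
- apply: connected_continuous_connected; first exact: segment_connected.
  exact: continuous_subspaceT.
Qed.

End Plane_topology.

(** * Complex derivatives and derivatives of plane curves *)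

Section Derivatives.
Context {R : realType}.

Lemma is_derive_realP (f : R -> R) (x d : R) : is_derive x 1 f d <->
  forall e : R, 0 < e -> exists2 r : R, 0 < r &
    forall h, `|h| < r -> `|f (x + h) - f x - d * h| <= e * `|h|.
Proof.
have qE (h : R) : h != 0 ->
    f (x + h) - f x - d * h = h * (h^-1 *: ((f \o shift x) (h *: 1) - f x) - d).
  move=> h0; rewrite /GRing.scale/= mulr1 mulrBr mulrA divff// mul1r.
  by rewrite [h + x]addrC [h * d]mulrC.
split=> [[fd fD] e e0|H].
  move: fd => /cvg_ex[l fl]; have ld : l = d.
    by rewrite -fD; apply/esym/cvg_lim => //; exact: fl.
  move: fl; rewrite ld => /cvgRP/(_ e e0) /nbhs_ballP[r /= r0 rP].
  exists r => // h hr; have [->|h0] := eqVneq h 0.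
    by rewrite addr0 subrr mulr0 subr0 normr0 mulr0.
  rewrite qE// normrM mulrC ler_wpM2r//.
  by apply/ltW/rP => //; rewrite /ball/= sub0r normrN.
have fl : h^-1 *: ((f \o shift x) (h *: 1) - f x) @[h --> 0^'] --> d.
  apply/cvgRP => e e0; have [|r r0 rP] := H (e / 2); first by rewrite divr_gt0.
  apply/nbhs_ballP; exists r => //= h; rewrite /ball/= sub0r normrN => hr h0.
  have := rP h hr; rewrite qE// normrM mulrC ler_pM2r ?normr_gt0// => /le_lt_trans.
  by apply; rewrite ltr_pdivrMr// mulr_natr mulr2n ltrDl.
by split; [apply/cvg_ex; exists d|exact: cvg_lim fl].
Qed.

Lemma is_derive_complexP (f : C R -> C R) (z d : C R) : is_derive z (1 : C R) f d <->
  forall e : R, 0 < e -> exists2 r : R, 0 < r &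
    forall h, cabs h < r -> cabs (f (z + h) - f z - d * h) <= e * cabs h.
Proof.
have qE (h : C R) : h != 0 ->
    f (z + h) - f z - d * h = h * (h^-1 *: ((f \o shift z) (h *: (1 : C R)) - f z) - d).
  move=> h0; rewrite /GRing.scale/= mulr1 mulrBr mulrA divff// mul1r.
  by rewrite [h + z]addrC [h * d]mulrC.
split=> [[fd fD] e e0|H].
  move: fd => /cvg_ex[l fl]; have ld : l = d.
    by rewrite -fD; apply/esym/cvg_lim => //; exact: fl.
  move: fl; rewrite ld => /cvgCP/(_ e e0) /nbhsCP[r /= r0 rP].
  exists r => // h hr; have [->|h0] := eqVneq h 0.
    by rewrite addr0 subrr mulr0 subr0 cabs0 mulr0.
  rewrite qE// cabsM mulrC ler_wpM2r ?cabs_ge0//.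
  by apply/ltW/rP => //; rewrite subr0.
have fl : h^-1 *: ((f \o shift z) (h *: (1 : C R)) - f z) @[h --> 0^'] --> d.
  apply/cvgCP => e e0; have [|r r0 rP] := H (e / 2); first by rewrite divr_gt0.
  apply/nbhsCP; exists r => //= h; rewrite subr0 => hr h0.
  have := rP h hr; rewrite qE// cabsM mulrC ler_pM2r ?cabs_gt0// => /le_lt_trans.
  by apply; rewrite ltr_pdivrMr// mulr_natr mulr2n ltrDl.
by split; [apply/cvg_ex; exists d|exact: cvg_lim fl].
Qed.

(** The derivative of a curve is taken coordinatewise, because the plane carries
    the structure of a normed space over itself and not over the reals. *)
Definition is_curve_derive (c : R -> C R) (t : R) (d : C R) :=
  is_derive t 1 (fun s => complex.Re (c s)) (complex.Re d) /\
  is_derive t 1 (fun s => complex.Im (c s)) (complex.Im d).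

Lemma is_curve_deriveP (c : R -> C R) (t : R) (d : C R) : is_curve_derive c t d <->
  forall e : R, 0 < e -> exists2 r : R, 0 < r &
    forall h, `|h| < r -> cabs (c (t + h) - c t - d * toC h) <= e * `|h|.
Proof.
have ReE h : complex.Re (c (t + h)) - complex.Re (c t) - complex.Re d * h =
    complex.Re (c (t + h) - c t - d * toC h).
  by rewrite !ReImE /= mulr0 subr0.
have ImE h : complex.Im (c (t + h)) - complex.Im (c t) - complex.Im d * h =
    complex.Im (c (t + h) - c t - d * toC h).
  by rewrite !ReImE /= mulr0 add0r.
split=> [[/is_derive_realP dr /is_derive_realP di] e e0|H].
  have e2 : 0 < e / 2 by rewrite divr_gt0.
  have [r r0 rP] := dr _ e2; have [s s0 sP] := di _ e2.
  exists (Num.min r s); first by rewrite lt_min r0.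
  move=> h; rewrite lt_min => /andP[hr hs].
  rewrite (le_trans (cabs_le_ReIm _))// -ReE -ImE [in leRHS](splitr e) mulrDl.
  by rewrite lerD ?rP ?sP.
split; apply/is_derive_realP => e e0; have [r r0 rP] := H e e0; exists r => // h hr.
  by rewrite ReE (le_trans (Re_le_cabs _))// rP.
by rewrite ImE (le_trans (Im_le_cabs _))// rP.
Qed.

Lemma curve_derive_continuous (c : R -> C R) t d : is_curve_derive c t d ->
  {for t, continuous c}.
Proof.
move=> [[dr _] [di _]]; apply: cvg_ReIm.
  by apply: differentiable_continuous; exact/derivable1_diffP.
by apply: differentiable_continuous; exact/derivable1_diffP.
Qed.

Lemma complex_derive_continuous (f : C R -> C R) z d :
  is_derive z (1 : C R) f d -> {for z, continuous f}.
Proof.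
by move=> [fd _]; apply: differentiable_continuous; exact/derivable1_diffP.
Qed.

Lemma is_curve_derive_comp (f : C R -> C R) (c : R -> C R) t d d' :
  is_curve_derive c t d -> is_derive (c t) (1 : C R) f d' ->
  is_curve_derive (f \o c) t (d' * d).
Proof.
move=> /is_curve_deriveP dc /is_derive_complexP df.
apply/is_curve_deriveP => e e0.
pose D := cabs d + 1; have D0 : 0 < D by rewrite ltr_wpDl ?cabs_ge0.
pose D' := cabs d' + 1; have D'0 : 0 < D' by rewrite ltr_wpDl ?cabs_ge0.
have [|r r0 rP] := df (e / 2 / D); first by rewrite !divr_gt0.
have [|s s0 sP] := dc (e / 2 / D'); first by rewrite !divr_gt0.
have [u u0 uP] := dc 1 ltr01.
exists (Num.min (Num.min s u) (r / D)); first by rewrite !lt_min s0 u0 divr_gt0.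
move=> h; rewrite !lt_min => /andP[/andP[hs hu] hr].
have ch : cabs (c (t + h) - c t) <= D * `|h|.
  rewrite -[X in cabs X](subrK (d * toC h)) (le_trans (cabsD _ _))//.
  by rewrite cabsM cabs_toC /D [in leRHS]mulrDl addrC lerD// uP.
have := rP (c (t + h) - c t); rewrite subrKC => /(_ _)/wrap[].
  by rewrite (le_lt_trans ch)// mulrC -ltr_pdivlMr.
move=> H1.
have -> : (f \o c) (t + h) - (f \o c) t - d' * d * toC h =
    (f (c (t + h)) - f (c t) - d' * (c (t + h) - c t)) +
    d' * (c (t + h) - c t - d * toC h).
  by rewrite /=; ring.
rewrite (le_trans (cabsD _ _))// [in leRHS](splitr e) mulrDl lerD//.
  have -> : e / 2 * `|h| = e / 2 / D * (D * `|h|) by field; rewrite lt0r_neq0.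
  by rewrite (le_trans H1)// ler_wpM2l// !divr_ge0// ltW.
rewrite cabsM (le_trans (ler_wpM2l (cabs_ge0 _) (sP h hs)))//.
rewrite mulrA ler_wpM2r// mulrCA -[leRHS]mulr1 ler_wpM2l ?divr_ge0 ?(ltW e0)//.
by rewrite ler_pdivrMr// mul1r /D' lerDl.
Qed.

(** The scalar mean value theorem is applied to the component of the curve in
    the direction of the error to be estimated. *)
Lemma curve_mean_value (c dc : R -> C R) (v : C R) (e a b : R) : a <= b ->
  (forall s, a <= s <= b -> is_curve_derive c s (dc s)) ->
  (forall s, a <= s <= b -> cabs (dc s - v) <= e) ->
  cabs (c b - c a - v * toC (b - a)) <= e * (b - a).
Proof.
move=> ab cD ce.
set D := c b - c a - v * toC (b - a).
pose p s := complex.Re D * (complex.Re (c s) - complex.Re v * s) +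
  complex.Im D * (complex.Im (c s) - complex.Im v * s).
pose dp s := complex.Re D * (complex.Re (dc s) - complex.Re v) +
  complex.Im D * (complex.Im (dc s) - complex.Im v).
have pD s : a <= s <= b -> is_derive s 1 p (dp s).
  move=> sab; have [cr ci] := cD s sab.
  rewrite /p; apply: is_derive_eq; rewrite /dp /GRing.scale/=; ring.
have [||s] := @MVT_segment _ p dp a b ab.
- by move=> x; rewrite in_itv/= => /andP[ax xb]; apply: pD; rewrite !ltW.
- apply: derivable_within_continuous => x; rewrite in_itv/= => xab.
  by have [] := pD x xab.
rewrite in_itv/= => sab pba.
have pE : p b - p a = cabs D ^+ 2.
  rewrite cabs_sqr /p.
  have -> : complex.Re D = complex.Re (c b) - complex.Re (c a) - complex.Re v * (b - a).
    by rewrite /D !ReImE/= mulr0 subr0.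
  have -> : complex.Im D = complex.Im (c b) - complex.Im (c a) - complex.Im v * (b - a).
    by rewrite /D !ReImE/= mulr0 add0r.
  ring.
have dpE : dp s <= cabs D * e.
  have -> : dp s = complex.Re (D^* * (dc s - v)) by rewrite /dp !ReImE; ring.
  rewrite (le_trans (ler_norm _))// (le_trans (Re_le_cabs _))//.
  by rewrite cabsM cabsJ ler_wpM2l ?cabs_ge0// ce.
have [D0|D0] := eqVneq (cabs D) 0.
  rewrite D0 mulr_ge0 ?subr_ge0//.
  by rewrite (le_trans (cabs_ge0 _) (ce s sab)).
have Dp : 0 < cabs D by rewrite lt_def D0 cabs_ge0.
rewrite -(ler_pM2l Dp) -expr2 -pE pba mulrA ler_wpM2r// subr_ge0//.
Qed.

End Derivatives.

(** * Differentiation of power series *)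

Section Power_series.
Context {R : realType}.

Lemma series0 (V : zmodType) (u : V ^nat) : series u 0%N = 0.
Proof. by rewrite /series /= big_geq. Qed.

Lemma Re_series (a : nat -> C R) n :
  complex.Re (series a n) = series (fun k => complex.Re (a k)) n.
Proof.
elim: n => [|n IH]; first by rewrite !series0.
by rewrite !seriesSr ReD IH.
Qed.

Lemma Im_series (a : nat -> C R) n :
  complex.Im (series a n) = series (fun k => complex.Im (a k)) n.
Proof.
elim: n => [|n IH]; first by rewrite !series0.
by rewrite !seriesSr ImD IH.
Qed.

Lemma dominated_series_cvg (a : nat -> C R) (b : nat -> R) :
  (forall n, cabs (a n) <= b n) -> cvgn (series b) -> cvgn (series a).
Proof.
move=> ab cb.
have b0 n : 0 <= b n by rewrite (le_trans (cabs_ge0 _) (ab n)).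
have cr : cvgn (series (fun k => complex.Re (a k))).
  apply: normed_cvg; apply: (@series_le_cvg _ _ b) => //= n.
  by rewrite (le_trans (Re_le_cabs _)).
have ci : cvgn (series (fun k => complex.Im (a k))).
  apply: normed_cvg; apply: (@series_le_cvg _ _ b) => //= n.
  by rewrite (le_trans (Im_le_cabs _)).
apply/cvg_ex; exists (limn (series (fun k => complex.Re (a k))) +i*
                      limn (series (fun k => complex.Im (a k))))%C.
apply: cvg_ReIm => /=.
  by under eq_fun do rewrite Re_series.
by under eq_fun do rewrite Im_series.
Qed.

Lemma halving_series_cvg (M : R) : cvgn (series (fun n => M * (1 / 2) ^+ n)).
Proof. by apply: is_cvg_geometric_series; rewrite ger0_norm; lra. Qed.

Lemma halving_series_le (M : R) n : 0 <= M ->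
  series (fun n => M * (1 / 2) ^+ n) n <= 2 * M.
Proof.
move=> M0; suff -> : series (fun n => M * (1 / 2) ^+ n) n = 2 * M * (1 - (1 / 2) ^+ n).
  rewrite -[leRHS]mulr1 ler_wpM2l ?mulr_ge0// gerBl exprn_ge0//.
elim: n => [|n IH]; first by rewrite series0 expr0 subrr mulr0.
by rewrite seriesSr IH exprS; field.
Qed.

(** The remainder of exponent [n + 1] is [x + h] times that of exponent [n], plus
    [n%:R * x ^+ n.-1 * h ^+ 2].  The factor [K ^+ 2] on the left avoids the
    exponent [n - 2]. *)
Lemma expr_taylor2 (x h : C R) (K : R) n : 0 <= K -> cabs x <= K -> cabs (x + h) <= K ->
  cabs ((x + h) ^+ n - x ^+ n - n%:R * x ^+ n.-1 * h) * K ^+ 2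
    <= n%:R ^+ 2 * K ^+ n * cabs h ^+ 2.
Proof.
move=> K0 xK xhK; elim: n => [|n IH].
  by rewrite !expr0 subrr !mul0r subr0 cabs0 expr0n/= !mul0r.
have -> : (x + h) ^+ n.+1 - x ^+ n.+1 - n.+1%:R * x ^+ n.+1.-1 * h =
    (x + h) * ((x + h) ^+ n - x ^+ n - n%:R * x ^+ n.-1 * h) +
    n%:R * x ^+ n.-1 * h ^+ 2.
  case: n {IH} => [|n]; first by rewrite /=; ring.
  by rewrite /= -[n.+2%:R]natr1 !(exprS _ n.+1) (exprS _ n) (exprS x n); ring.
have nK : n%:R * cabs x ^+ n.-1 * K ^+ 2 <= n%:R * K ^+ n.+1.
  case: n {IH} => [|n]; first by rewrite !mul0r.
  rewrite -mulrA ler_wpM2l// [n.+1.-1]/= -[n.+2]addn2 exprD ler_wpM2r ?exprn_ge0//.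
  by rewrite lerXn2r ?nnegrE ?cabs_ge0.
have cn m : cabs (m%:R : C R) = m%:R.
  by rewrite -(rmorph_nat (real_complex R)) (cabs_toC m%:R) ger0_norm.
rewrite (le_trans (ler_wpM2r _ (cabsD _ _))) ?exprn_ge0//.
rewrite mulrDl !cabsM !cabsX cn.
have h1 : cabs (x + h) * cabs ((x + h) ^+ n - x ^+ n - n%:R * x ^+ n.-1 * h) * K ^+ 2
    <= K * (n%:R ^+ 2 * K ^+ n * cabs h ^+ 2).
  by rewrite -mulrA ler_pM ?mulr_ge0 ?exprn_ge0 ?cabs_ge0.
have h2 : n%:R * cabs x ^+ n.-1 * cabs h ^+ 2 * K ^+ 2 <= n%:R * K ^+ n.+1 * cabs h ^+ 2.
  by rewrite mulrAC ler_wpM2r ?exprn_ge0 ?cabs_ge0.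
apply: (le_trans (lerD h1 h2)).
have -> : K * (n%:R ^+ 2 * K ^+ n * cabs h ^+ 2) + n%:R * K ^+ n.+1 * cabs h ^+ 2 =
   (n%:R ^+ 2 + n%:R) * (K ^+ n.+1 * cabs h ^+ 2) by rewrite (exprS K); ring.
rewrite -[leRHS]mulrA ler_wpM2r ?mulr_ge0 ?exprn_ge0 ?cabs_ge0//.
by rewrite -natr1; have := ler0n R n; nra.
Qed.

(** If the coefficients satisfy [cabs (c n) * rho ^+ n <= M], then on the disc of
    radius [rho / 8] every series obtained from two formal differentiations is
    dominated by a geometric series of ratio [1 / 2], because [n <= 2 ^ n].  As
    analyticity is a local notion, this small disc is enough. *)
Lemma analytic_at_derive (f : C R -> C R) (z0 : C R) : analytic_at f z0 ->
  (\forall z \near z0, derivable f z 1) /\ analytic_at (derive1 f) z0.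
Proof.
move=> [c /nbhsCP[r r0 cf]].
have [rho [rho0 rhoE]] : exists rho, 0 < rho /\ rho = r / 2 by exists (r / 2); rewrite divr_gt0.
have cfh h : cabs h < r -> [series c k * h ^+ k]_k @ \oo --> f (z0 + h).
  by move=> hr; have := cf (z0 + h); rewrite addrC addKr => /(_ hr).
have [M M0 cM] : exists2 M : R, 0 <= M & forall n, cabs (c n) * rho ^+ n <= M.
  have rr : cabs (toC rho) < r by rewrite cabs_toC gtr0_norm// rhoE; lra.
  have /cvgP/cvg_series_cvg_0/cvgCP/(_ 1 ltr01) := cfh _ rr.
  move=> [N _ NP].
  exists (\sum_(i < N) cabs (c i) * rho ^+ i + 1).
    by rewrite addr_ge0// sumr_ge0// => i _; rewrite mulr_ge0 ?cabs_ge0 ?exprn_ge0 ?ltW.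
  move=> n; have [nN|Nn] := ltnP n N.
    rewrite (bigD1 (Ordinal nN))//= -addrA lerDl addr_ge0// sumr_ge0// => i _.
    by rewrite mulr_ge0 ?cabs_ge0 ?exprn_ge0 ?ltW.
  have := NP n Nn; rewrite /= subr0 cabsM cabsX cabs_toC gtr0_norm// => /ltW H.
  by rewrite (le_trans H)// lerDr sumr_ge0// => i _; rewrite mulr_ge0 ?cabs_ge0 ?exprn_ge0 ?ltW.
have [K [K0 KE]] : exists K, 0 < K /\ K = rho / 8 by exists (rho / 8); rewrite divr_gt0.
have Kr : K < r by rewrite KE rhoE; lra.
have cK n : cabs (c n) * (n%:R ^+ 2 * K ^+ n) <= M * (1 / 2) ^+ n.
  have -> : K ^+ n = rho ^+ n * ((1 / 2) ^+ n * (1 / 2) ^+ n * (1 / 2) ^+ n).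
    by rewrite -!exprMn KE; congr (_ ^+ _); field.
  have n1 : n%:R * (1 / 2) ^+ n <= 1 :> R.
    rewrite expr_div_n expr1n mulrA mulr1 ler_pdivrMr ?exprn_gt0// mul1r.
    by rewrite -natrX ler_nat ltnW// ltn_expl.
  have n0 : 0 <= n%:R * (1 / 2) ^+ n :> R by rewrite mulr_ge0 ?exprn_ge0.
  have -> : cabs (c n) * (n%:R ^+ 2 * (rho ^+ n * ((1 / 2) ^+ n * (1 / 2) ^+ n * (1 / 2) ^+ n)))
    = (cabs (c n) * rho ^+ n) * ((n%:R * (1 / 2) ^+ n) ^+ 2 * (1 / 2) ^+ n) by ring.
  apply: ler_pM => //; rewrite ?mulr_ge0 ?cabs_ge0 ?exprn_ge0// ?(ltW rho0)//.
  by rewrite ler_piMl ?exprn_ge0// expr_le1.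
pose D k := k.+1%:R * c k.+1.
have cn m : cabs (m%:R : C R) = m%:R.
  by rewrite -(rmorph_nat (real_complex R)) (cabs_toC m%:R) ger0_norm.
have Dcvg h : cabs h < K -> cvgn [series D k * h ^+ k]_k.
  move=> hK; apply: (@dominated_series_cvg _ (fun n => M / K * (1 / 2) ^+ n)); last first.
    exact: halving_series_cvg.
  move=> n; rewrite !cabsM cabsX cn.
  rewrite [leRHS]mulrAC ler_pdivlMr//.
  have h1 : cabs h ^+ n <= K ^+ n by rewrite lerXn2r ?nnegrE ?cabs_ge0// ltW.
  have h2 := cK n.+1.
  have h3 : (1 / 2) ^+ n.+1 <= (1 / 2) ^+ n :> R.
    by rewrite exprS ler_piMl ?exprn_ge0//; lra.
  have h4 : n.+1%:R * cabs (c n.+1) * cabs h ^+ n * K <=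
            cabs (c n.+1) * (n.+1%:R ^+ 2 * K ^+ n.+1).
    have -> : n.+1%:R * cabs (c n.+1) * cabs h ^+ n * K =
       cabs (c n.+1) * (n.+1%:R * (cabs h ^+ n * K)) by ring.
    rewrite ler_wpM2l ?cabs_ge0// ler_pM// ?mulr_ge0 ?exprn_ge0 ?cabs_ge0 ?(ltW K0)//.
      by rewrite expr2 ler_peMl// ler1n.
    by rewrite exprSr ler_wpM2r// ltW.
  by rewrite (le_trans h4)// (le_trans h2)// ler_wpM2l.
pose g h := limn [series D k * h ^+ k]_k.
pose B := 2 * M / K ^+ 2.
have B0 : 0 <= B by rewrite /B divr_ge0 ?exprn_ge0 ?mulr_ge0// ltW.
have rem x h : cabs x < K -> cabs (x + h) < K ->
    cabs (f (z0 + (x + h)) - f (z0 + x) - g x * h) <= B * cabs h ^+ 2.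
  move=> xK xhK.
  pose T n := c n * ((x + h) ^+ n - x ^+ n - n%:R * x ^+ n.-1 * h).
  have TE n : series T n.+1 = [series c k * (x + h) ^+ k]_k n.+1 -
      [series c k * x ^+ k]_k n.+1 - [series D k * x ^+ k]_k n * h.
    elim: n => [|n IH].
      rewrite !seriesSr !series0.
      by rewrite /T /= !expr0; ring.
    rewrite seriesSr IH [in RHS]seriesSr [in X in _ = _ - X - _]seriesSr.
    rewrite [in X in _ = _ - X * _]seriesSr /T /D /=; ring.
  have Tl : series T n.+1 @[n --> \oo] --> f (z0 + (x + h)) - f (z0 + x) - g x * h.
    under eq_fun do rewrite TE.
    apply: cvgB; last by apply: cvgMl; exact: Dcvg.
    apply: cvgB.
      by have := cfh _ (lt_trans xhK Kr); rewrite -cvg_shiftS.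
    by have := cfh _ (lt_trans xK Kr); rewrite -cvg_shiftS.
  have TB n : cabs (series T n) <= B * cabs h ^+ 2.
    have h1 : cabs (series T n) * K ^+ 2 <= series (fun n => M * cabs h ^+ 2 * (1 / 2) ^+ n) n.
      elim: n => [|n IH].
        by rewrite !series0 cabs0 mul0r.
      rewrite !seriesSr (le_trans (ler_wpM2r _ (cabsD _ _))) ?exprn_ge0 ?(ltW K0)//.
      have h2 := expr_taylor2 n (ltW K0) (ltW xK) (ltW xhK).
      have h3 := ler_wpM2r (exprn_ge0 2 (cabs_ge0 h)) (cK n).
      rewrite mulrDl lerD//= /T cabsM.
      rewrite -(mulrA (cabs _)) (le_trans (ler_wpM2l (cabs_ge0 _) h2))// mulrA (le_trans h3)//.
      by rewrite mulrAC.
    have h2 := le_trans h1 (halving_series_le n (mulr_ge0 M0 (exprn_ge0 2 (cabs_ge0 h)))).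
    rewrite -(ler_pM2r (exprn_gt0 2 K0)) (le_trans h2)// /B le_eqVlt; apply/orP; left.
    by apply/eqP; field; rewrite lt0r_neq0.
  apply: (cvgr_to_le (cvg_comp _ _ Tl (@cabs_continuous R _))).
  by apply: nearW => n; exact: TB.
have fD x : cabs x < K -> is_derive (z0 + x) (1 : C R) f (g x).
  move=> xK; apply/is_derive_complexP => e e0.
  exists (Num.min (K - cabs x) (e / (B + 1))).
    by rewrite lt_min subr_gt0 xK divr_gt0// ltr_wpDl.
  move=> h; rewrite lt_min => /andP[h1 h2].
  rewrite -(addrA z0) (le_trans (rem x h xK _))//.
    by rewrite (le_lt_trans (cabsD _ _))// -ltrBrDl.
  rewrite expr2 mulrA ler_wpM2r ?cabs_ge0//.
  move: h2; rewrite ltr_pdivlMr ?ltr_wpDl// => h2.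
  by have := cabs_ge0 h; nra.
split.
  apply/nbhsCP; exists K => // z zK; have [+ _] := fD _ zK.
  by rewrite subrKC.
exists D; apply/nbhsCP; exists K => // z zK.
have -> : derive1 f z = g (z - z0).
  by rewrite derive1E; have := fD _ zK; rewrite subrKC => -[].
exact: Dcvg.
Qed.

End Power_series.

(** * Functions with complex derivatives of all orders *)

Section Holomorphic.
Context {R : realType}.
Implicit Types (U : set (C R)) (f g : C R -> C R).

(** Analyticity on an open set is only used through the existence of derivatives of
    all orders, a property that products and inverses preserve by an immediate
    induction on the order, without any manipulation of power series. *)
Fixpoint derivable_upto (n : nat) U f : Prop :=
  if n is m.+1 then
    (forall z, U z -> derivable f z 1) /\ derivable_upto m U (derive1 f)
  else True.

Lemma derivable_uptoS n U f : derivable_upto n.+1 U f =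
  ((forall z, U z -> derivable f z 1) /\ derivable_upto n U (derive1 f)).
Proof. by []. Qed.

Definition holomorphic_on U f := forall n, derivable_upto n U f.

Lemma derivable_uptoW n U f : derivable_upto n.+1 U f -> derivable_upto n U f.
Proof.
elim: n f => [//|n IH] f.
by rewrite derivable_uptoS => -[df hf]; rewrite derivable_uptoS; split; [|exact: IH].
Qed.

Lemma derivable_upto_ext n U f g : open U -> (forall z, U z -> f z = g z) ->
  derivable_upto n U f -> derivable_upto n U g.
Proof.
move=> oU; elim: n f g => [//|n IH] f g fg; rewrite !derivable_uptoS => -[df hf].
have nfg z : U z -> {near z, f =1 g}.
  by move=> Uz; apply: filterS (open_nbhs_nbhs (conj oU Uz)); exact: fg.
split; first by move=> z Uz; exact: near_eq_derivable (nfg z Uz) (df z Uz).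
apply: IH hf => z Uz; rewrite !derive1E; exact: near_eq_derive (nfg z Uz).
Qed.

Lemma derivable_upto_cst n U (c : C R) : derivable_upto n U (fun=> c).
Proof.
elim: n c => [//|n IH] c; rewrite derivable_uptoS.
split; first by move=> z _; exact: derivable_cst.
have -> : derive1 (fun=> c) = (fun=> 0 : C R); last exact: IH.
by apply/funext => z; rewrite derive1E derive_cst.
Qed.

Lemma derivable_uptoD n U f g : open U -> derivable_upto n U f ->
  derivable_upto n U g -> derivable_upto n U (fun z => f z + g z).
Proof.
move=> oU; elim: n f g => [//|n IH] f g; rewrite !derivable_uptoS => -[df hf] [dg hg].
split; first by move=> z Uz; exact: derivableD (df z Uz) (dg z Uz).
apply: derivable_upto_ext oU _ (IH _ _ hf hg) => z Uz.
by rewrite !derive1E (deriveD (df z Uz) (dg z Uz)).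
Qed.

Lemma derivable_uptoM n U f g : open U -> derivable_upto n U f ->
  derivable_upto n U g -> derivable_upto n U (fun z => f z * g z).
Proof.
move=> oU; elim: n f g => [//|n IH] f g Hf Hg.
have [Wf Wg] := (derivable_uptoW Hf, derivable_uptoW Hg).
move: Hf Hg; rewrite !derivable_uptoS => -[df hf] [dg hg].
split; first by move=> z Uz; exact: derivableM (df z Uz) (dg z Uz).
apply: derivable_upto_ext oU _ (derivable_uptoD oU (IH _ _ Wf hg) (IH _ _ Wg hf)).
by move=> z Uz; rewrite !derive1E (deriveM (df z Uz) (dg z Uz)).
Qed.

Lemma derivable_uptoV n U f : open U -> (forall z, U z -> f z != 0) ->
  derivable_upto n U f -> derivable_upto n U (fun z => (f z)^-1).
Proof.
move=> oU f0; elim: n => [//|n IH] Hf.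
have hV := IH (derivable_uptoW Hf).
move: Hf; rewrite !derivable_uptoS => -[df hf].
split; first by move=> z Uz; exact: derivableV (f0 z Uz) (df z Uz).
apply: derivable_upto_ext oU _ (derivable_uptoM oU (derivable_uptoM oU
  (derivable_upto_cst n U (-1)) (derivable_uptoM oU hV hV)) hf).
move=> z Uz; rewrite !derive1E (deriveV (f0 z Uz) (df z Uz)).
by rewrite /GRing.scale/= mulN1r expr2 invfM.
Qed.

Lemma holomorphic_derivable U f z : holomorphic_on U f -> U z ->
  derivable f z 1.
Proof. by move=> /(_ 1%N); rewrite derivable_uptoS => -[df _] /df. Qed.

Lemma holomorphic_derive U f : holomorphic_on U f -> holomorphic_on U (derive1 f).
Proof. by move=> hf n; have := hf n.+1; rewrite derivable_uptoS => -[]. Qed.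

Lemma holomorphic_is_derive U f z : holomorphic_on U f -> U z ->
  is_derive z (1 : C R) f (derive1 f z).
Proof.
by move=> hf Uz; split; [exact: holomorphic_derivable hf Uz|rewrite derive1E].
Qed.

Lemma holomorphic_continuous U f z : holomorphic_on U f -> U z ->
  {for z, continuous f}.
Proof.
by move=> hf Uz; apply: complex_derive_continuous; exact: holomorphic_is_derive hf Uz.
Qed.

Lemma analytic_holomorphic U f : analytic_on U f -> holomorphic_on U f.
Proof.
move=> af n; elim: n f af => [//|n IH] f af; rewrite derivable_uptoS.
split; first by move=> z /af/analytic_at_derive[/nbhs_singleton].
by apply: IH => z /af/analytic_at_derive[].
Qed.

Lemma holomorphicM U f g : open U -> holomorphic_on U f -> holomorphic_on U g ->
  holomorphic_on U (fun z => f z * g z).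
Proof. by move=> oU hf hg n; exact: derivable_uptoM. Qed.

Lemma holomorphicV U f : open U -> (forall z, U z -> f z != 0) ->
  holomorphic_on U f -> holomorphic_on U (fun z => (f z)^-1).
Proof. by move=> oU f0 hf n; exact: derivable_uptoV. Qed.

Lemma holomorphic_G U f w : open U -> (forall z, U z -> derive1 f z != 0) ->
  holomorphic_on U f -> holomorphic_on U w -> holomorphic_on U (G_op f w).
Proof.
move=> oU f'0 hf hw.
have hg : holomorphic_on U (fun z => f z / derive1 f z).
  by apply: holomorphicM => //; apply: holomorphicV => //; exact: holomorphic_derive.
move=> n; apply: (derivable_uptoD oU); apply: (derivable_uptoM oU).
- by apply: (derivable_uptoM oU) => //; exact: derivable_upto_cst.
- exact: holomorphic_derive.
- exact: holomorphic_derive.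
- exact: hw.
Qed.

Lemma holomorphic_G_iter U f w k : open U -> (forall z, U z -> derive1 f z != 0) ->
  holomorphic_on U f -> holomorphic_on U w -> holomorphic_on U (G_iter f w k).
Proof.
move=> oU f'0 hf hw; elim: k => [//|k IH].
by rewrite /G_iter iterS; exact: holomorphic_G.
Qed.

End Holomorphic.

(** * Local inverses *)

Section Local_inverse.
Context {R : realType}.

Lemma segment_curve_derive (z w : C R) (t : R) :
  is_curve_derive (fun s => z + toC s * w) t w.
Proof.
apply/is_curve_deriveP => e e0; exists 1 => // h _.
rewrite toCD (_ : _ - _ - _ = 0) ?cabs0; last by ring.
by rewrite mulr_ge0// ltW.
Qed.

(** The mean value inequality on the segment from [w] to [z], which stays in the
    ball where [derive1 f] is close to [derive1 f z0]. *)
Lemma strict_derivative (f : C R -> C R) (z0 : C R) (e : R) : 0 < e ->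
  (\forall z \near z0, derivable f z 1) -> {for z0, continuous (derive1 f)} ->
  exists2 r : R, 0 < r & forall z w, cabs (z - z0) < r -> cabs (w - z0) < r ->
    cabs (f z - f w - derive1 f z0 * (z - w)) <= e * cabs (z - w).
Proof.
move=> e0 /nbhsCP[r1 r10 r1P] /cvgCP/(_ e e0)/nbhsCP[r2 r20 r2P].
exists (Num.min r1 r2); first by rewrite lt_min r10.
move=> z w; rewrite !lt_min => /andP[z1 z2] /andP[w1 w2].
pose c s := w + toC s * (z - w).
have cP (r : R) s : 0 <= s <= 1 -> cabs (z - z0) < r -> cabs (w - z0) < r ->
    cabs (c s - z0) < r.
  move=> /andP[s0 s1] zr wr.
  have -> : c s - z0 = toC s * (z - z0) + toC (1 - s) * (w - z0).
    by rewrite /c toCD toCN; change (toC 1) with (1 : C R); ring.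
  rewrite (le_lt_trans (cabsD _ _))// !cabsM !cabs_toC !ger0_norm ?subr_ge0//.
  have [->|sn0] := eqVneq s 0; first by rewrite subr0 mul0r add0r mul1r.
  have sp : 0 < s by rewrite lt_def sn0.
  by have := cabs_ge0 (w - z0); nra.
have cD s : 0 <= s <= 1 -> is_curve_derive (f \o c) s ((derive1 f) (c s) * (z - w)).
  move=> s01; apply: is_curve_derive_comp; first exact: segment_curve_derive.
  by split; [exact: r1P (cP _ _ s01 z1 w1)|rewrite derive1E].
have := @curve_mean_value _ (f \o c) (fun s => (derive1 f) (c s) * (z - w))
  (derive1 f z0 * (z - w)) (e * cabs (z - w)) 0 1 ler01 cD.
rewrite subr0 mulr1 /= /c; change (toC 1) with (1 : C R); change (toC 0) with (0 : C R).
rewrite mul0r addr0 mul1r mulr1 subrKC; apply => s s01.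
rewrite -mulrBl cabsM ler_wpM2r ?cabs_ge0// ltW//; apply: r2P; exact: cP.
Qed.

(** The increments form a series dominated by a geometric one. *)
Lemma cauchy_geometric_cvg (u : nat -> C R) (M : R) :
  (forall n, cabs (u n.+1 - u n) <= M * (1 / 2) ^+ n) ->
  exists2 l, u @ \oo --> l & cabs (l - u 0%N) <= 2 * M.
Proof.
move=> uM.
have M0 : 0 <= M by have := uM 0%N; rewrite expr0 mulr1; apply: le_trans; exact: cabs_ge0.
have uE n : u n = u 0%N + series (fun k => u k.+1 - u k) n.
  elim: n => [|n IH]; first by rewrite series0 addr0.
  by rewrite seriesSr addrA -IH subrKC.
have /cvg_ex[s sl] := dominated_series_cvg uM (@halving_series_cvg _ M).
have : u 0%N + series (fun k => u k.+1 - u k) n @[n --> \oo] --> u 0%N + s.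
  by apply: cvgD; [exact: cvg_cst|exact: sl].
rewrite -(funext uE) => ul.
exists (u 0%N + s) => //; rewrite addrC addKr.
apply: (cvgr_to_le (cvg_comp _ _ sl (@cabs_continuous R _))).
apply: nearW => n; rewrite (le_trans _ (halving_series_le n M0))// /=.
elim: n => [|n IH]; first by rewrite !series0 cabs0.
by rewrite !seriesSr (le_trans (cabsD _ _))// lerD//.
Qed.

(** Near a point where the derivative does not vanish, [z - (f z - w) / derive1 f z0]
    is a contraction of ratio [1 / 2] whose fixed point is the preimage of [w]. *)
Lemma local_inverse (f : C R -> C R) (z0 : C R) :
  (\forall z \near z0, derivable f z 1 /\ derive1 f z != 0) -> {for z0, continuous (derive1 f)} ->
  exists phi : C R -> C R,
    [/\ \forall w \near f z0, f (phi w) = w /\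
          is_derive w (1 : C R) phi ((derive1 f) (phi w))^-1,
        {for f z0, continuous phi}, phi (f z0) = z0 &
        \forall z \near z0 & w \near f z0, f z = w -> z = phi w].
Proof.
move=> dn0 f'c.
have d0 : derive1 f z0 != 0 by have [] := nbhs_singleton dn0.
have dn : \forall z \near z0, derivable f z 1 by apply: filterS dn0 => z [].
move/nbhsCP: dn0 => [r0 r00 r0P].
set d := derive1 f z0 in d0 *; have dp : 0 < cabs d by rewrite cabs_gt0.
have [|r1 r10 r1P] := @strict_derivative f z0 (cabs d / 2) _ dn f'c.
  by rewrite divr_gt0.
rewrite -/d in r1P; clearbody d.
pose r := Num.min r0 r1; have rp : 0 < r by rewrite lt_min r00.
have rP z w : cabs (z - z0) < r -> cabs (w - z0) < r ->
    cabs (f z - f w - d * (z - w)) <= cabs d / 2 * cabs (z - w).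
  by rewrite !lt_min => /andP[_ ?] /andP[_ ?]; exact: r1P.
have lower z w : cabs (z - z0) < r -> cabs (w - z0) < r ->
    cabs d / 2 * cabs (z - w) <= cabs (f z - f w).
  move=> zr wr; have := rP z w zr wr.
  have := cabsD (f z - f w) (- (f z - f w - d * (z - w))).
  by rewrite subKr cabsN cabsM; lra.
pose T w z := z - (f z - w) / d.
have TT w z z' : cabs (z - z0) < r -> cabs (z' - z0) < r ->
    cabs (T w z - T w z') <= 1 / 2 * cabs (z - z').
  move=> zr z'r; have -> : T w z - T w z' = - ((f z - f z' - d * (z - z')) / d).
    by rewrite /T; field.
  rewrite cabsN cabsM cabsV ler_pdivrMr// (le_trans (rP _ _ zr z'r))//.
  by lra.
(* The first step of the iteration from [z0] is shorter than [r / 4] and each of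
   the next ones is at most half of the previous one: the orbit stays in the ball
   where [T w] contracts. *)
pose rho := cabs d * r / 4; have rhop : 0 < rho by rewrite divr_gt0 ?mulr_gt0.
have ex w : cabs (w - f z0) < rho -> exists2 z, cabs (z - z0) < r & f z = w.
  move=> wr; pose u n := iter n (T w) z0.
  pose M := cabs (w - f z0) / cabs d.
  have M0 : 0 <= M by rewrite divr_ge0 ?cabs_ge0.
  have Mr : 2 * M < r.
    by move: wr; rewrite /rho /M mulrA ltr_pdivrMr// => wr; nra.
  have u01 : cabs (u 1%N - u 0%N) = M.
    by rewrite /u /= /T addrAC subrr add0r cabsN cabsM cabsV cabsB.
  have uS n : cabs (u n - z0) <= 2 * M * (1 - (1 / 2) ^+ n) /\
      cabs (u n.+1 - u n) <= M * (1 / 2) ^+ n.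
    elim: n => [|n [IH1 IH2]].
      by rewrite subrr cabs0 expr0 subrr mulr0 mulr1 u01.
    have h1 : cabs (u n.+1 - z0) <= 2 * M * (1 - (1 / 2) ^+ n.+1).
      rewrite (le_trans (cabs_sub _ _ (u n)))// exprS; lra.
    split=> //.
    have pw m : 2 * M * (1 - (1 / 2) ^+ m) < r.
      rewrite (le_lt_trans _ Mr)//.
      by have : 0 <= (1 / 2) ^+ m :> R by []; nra.
    have h2 : cabs (u n - z0) < r by rewrite (le_lt_trans IH1).
    have h3 : cabs (u n.+1 - z0) < r by rewrite (le_lt_trans h1).
    by rewrite (le_trans (TT w _ _ h3 h2))// exprS; lra.
  have [z uz zM] := cauchy_geometric_cvg (fun n => (uS n).2).
  have zr : cabs (z - z0) < r by rewrite (le_lt_trans zM).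
  exists z => //.
  have Tz : T w z = z.
    have : u n.+1 @[n --> \oo] --> T w z.
      apply/cvgCP => e e0; move/cvgCP: (uz) => uz'.
      have zr' : 0 < r - cabs (z - z0) by rewrite subr_gt0.
      near=> n.
      have h : cabs (u n - z) < e by near: n; exact: uz'.
      have h' : cabs (u n - z0) < r.
        rewrite (le_lt_trans (cabs_sub _ _ z))// -ltrBrDr.
        by near: n; exact: uz'.
      rewrite (le_lt_trans (TT w _ _ h' zr))//.
      by have := cabs_ge0 (u n - z); lra.
    rewrite (cvg_shiftS u) => uT; apply: cvg_unique uT uz => //.
  have : (f z - w) / d = 0 by rewrite -[RHS](subrr z) -[X in _ = _ - X]Tz /T subKr.
  by move/eqP; rewrite mulf_eq0 invr_eq0 (negbTE d0) orbF subr_eq0 => /eqP.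
have /choice[phi phiP] : forall w, exists z, cabs (w - f z0) < rho ->
    cabs (z - z0) < r /\ f z = w.
  move=> w; have [wr|wr] := pselect (cabs (w - f z0) < rho); last by exists 0.
  by have [z zr fz] := ex w wr; exists z.
have lip w w' : cabs (w - f z0) < rho -> cabs (w' - f z0) < rho ->
    cabs (phi w - phi w') <= 2 / cabs d * cabs (w - w').
  move=> /phiP[pr pf] /phiP[pr' pf']; have := lower _ _ pr pr'.
  rewrite pf pf' => h; rewrite mulrAC ler_pdivlMr//; lra.
have phi0 : phi (f z0) = z0.
  have z0r : cabs (f z0 - f z0) < rho by rewrite subrr cabs0.
  have [pr pf] := phiP _ z0r; apply/eqP; rewrite -subr_eq0 -cabs_eq0 eq_le cabs_ge0 andbT.
  have := lower _ z0 pr; rewrite subrr cabs0 pf subrr cabs0 => /(_ rp) h.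
  by rewrite -(ler_pM2l (divr_gt0 dp (ltr0Sn _ 1))) mulr0.
exists phi; split.
- apply/nbhsCP; exists rho; first exact: rhop.
  move=> w wr; have [pr pf] := phiP w wr; split; first exact: pf.
  have [dfw dn0w] : derivable f (phi w) 1 /\ (derive1 f) (phi w) != 0.
    by apply: r0P; move: pr; rewrite lt_min => /andP[].
  set b := (derive1 f) (phi w) in dn0w *; have bp : 0 < cabs b by rewrite cabs_gt0.
  have /is_derive_complexP fP : is_derive (phi w) (1 : C R) f b.
    by split; [exact: dfw|rewrite /b derive1E].
  clearbody b.
  apply/is_derive_complexP => e e0.
  have [|s s0 sP] := fP (e * cabs b * cabs d / 2); first by rewrite divr_gt0// !mulr_gt0.
  exists (Num.min (rho - cabs (w - f z0)) (s * cabs d / 2)).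
    by rewrite lt_min subr_gt0 wr divr_gt0// mulr_gt0.
  move=> h; rewrite lt_min => /andP[h1 h2].
  have whr : cabs (w + h - f z0) < rho.
    by rewrite addrAC (le_lt_trans (cabsD _ _))// -ltrBrDl.
  have L := lip _ _ whr wr; rewrite addrAC subrr add0r in L.
  have [_ pfh] := phiP _ whr.
  have Ls : cabs (phi (w + h) - phi w) < s.
    rewrite (le_lt_trans L)// mulrAC ltr_pdivrMr//; lra.
  have := sP _ Ls; rewrite subrKC pf pfh [w + h - w]addrAC subrr add0r => H.
  have -> : phi (w + h) - phi w - b^-1 * h = - (b^-1 * (h - b * (phi (w + h) - phi w))).
    by field.
  rewrite cabsN cabsM cabsV mulrC ler_pdivrMr// (le_trans H)//.
  rewrite -[leRHS]mulrAC.
  have -> : e * cabs b * cabs h = e * cabs b * cabs d / 2 * (2 / cabs d * cabs h).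
    by field; rewrite lt0r_neq0.
  by rewrite ler_wpM2l// divr_ge0// !mulr_ge0// ltW.
- apply/(cvgCP (F := nbhs (f z0))) => e e0; apply/nbhsCP.
  exists (Num.min rho (e * cabs d / 2)); first by rewrite lt_min rhop divr_gt0// mulr_gt0.
  move=> w; rewrite lt_min => /andP[w1 w2].
  rewrite (le_lt_trans (lip _ _ w1 _))// ?subrr ?cabs0//.
  by rewrite mulrAC ltr_pdivrMr//; lra.
- exact: phi0.
- exists ([set z | cabs (z - z0) < r], [set w | cabs (w - f z0) < rho]).
    by split; apply/near_cabs.
  move=> [z w] /= [zr wr] fz; have [pr pf] := phiP _ wr.
  have := lower _ _ zr pr; rewrite fz pf subrr cabs0 => h.
  apply/eqP; rewrite -subr_eq0 -cabs_eq0 eq_le cabs_ge0 andbT.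
  by rewrite -(ler_pM2l (divr_gt0 dp (ltr0Sn _ 1))) mulr0.
Unshelve. all: by end_near. Qed.

End Local_inverse.

(** * Sheets over a point *)

Section Compactness.

(** Otherwise the sets whose complement in [K] satisfies [Q] would form a proper
    filter with no cluster point in [K].  This turns a local finiteness or
    boundedness into a global one. *)
Lemma compact_ideal (T : topologicalType) (K : set T) (Q : set T -> Prop) :
  Q set0 -> (forall A B, A `<=` B -> Q B -> Q A) ->
  (forall A B, Q A -> Q B -> Q (A `|` B)) ->
  compact K -> (forall x, K x -> exists2 V, nbhs x V & Q V) -> Q K.
Proof.
move=> Q0 QS QU cK KQ; apply: contrapT => nQK.
pose F : set_system T := [set B | Q (K `\` B)].
have FF : ProperFilter F.
  split; first by rewrite /F/= setD0.
  split; rewrite /F/=.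
  - by rewrite setDT.
  - by move=> A B QA QB; rewrite /= setDIr; exact: QU.
  - by move=> A B AB; apply: QS => x [Kx nBx]; split=> // /AB.
have FK : F K by rewrite /F/= setDv.
have [x [Kx cx]] := cK F FF FK.
have [V xV QV] := KQ x Kx.
have FV : F (~` V).
  by apply: QS QV => y [_]; rewrite /setC/= => /contrapT.
by have [y []] := cx _ _ FV xV.
Qed.

End Compactness.

Section Sheets.
Context {R : realType}.
Variables (U : set (C R)) (f : C R -> C R).

Lemma halfway_disjoint (x y z : C R) : cabs (z - x) < cabs (x - y) / 2 ->
  cabs (z - y) < cabs (x - y) / 2 -> False.
Proof. by have := cabs_sub x y z; rewrite [cabs (x - z)]cabsB; lra. Qed.

Definition fiber (w : C R) : set (C R) := [set z | U z /\ f z = w].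

(** A full system of inverse branches of [f] near [w]; the values of the branches
    are required at [w] only, so that the notion can be asserted for all [w] near a
    given point. *)
Record sheets_at (n : nat) (phi : 'I_n -> C R -> C R) (w : C R) : Prop := SheetsAt {
  sheet_fiber : forall i, fiber w (phi i w) ;
  sheet_derive : forall i, is_derive w (1 : C R) (phi i) (derive1 f (phi i w))^-1 ;
  sheet_inj : forall i j, phi i w = phi j w -> i = j ;
  sheet_all : forall z, fiber w z -> exists i, z = phi i w }.

Hypothesis oU : open U.
Hypothesis hf : holomorphic_on U f.
Hypothesis f'0 : forall z, U z -> derive1 f z != 0.

Lemma local_inverse_on z : U z -> exists phi : C R -> C R,
    [/\ \forall w \near f z, fiber w (phi w) /\
          is_derive w (1 : C R) phi (derive1 f (phi w))^-1,
        {for f z, continuous phi}, phi (f z) = z &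
        \forall z' \near z & w \near f z, f z' = w -> z' = phi w].
Proof.
move=> Uz; have nU := open_nbhs_nbhs (conj oU Uz).
have [||phi [phiD phic phi0 phiinj]] := @local_inverse _ f z.
- apply: filterS nU => y Uy; split; [exact: holomorphic_derivable hf Uy|exact: f'0].
- exact: holomorphic_continuous (holomorphic_derive hf) Uz.
exists phi; split; [|exact: phic|exact: phi0|exact: phiinj].
have nphi : \forall w \near f z, U (phi w) by apply: phic; rewrite /= phi0.
by apply: filterS2 phiD nphi => w [? ?] ?.
Qed.

(** Over a point whose nearby fibers stay in a compact set, [f] is a finite
    covering: the fiber is finite since it is discrete, and nearby fibers consist
    of nothing but the values of the local inverses, by compactness. *)
Lemma local_sheets (K : set (C R)) (w0 : C R) : compact K -> K `<=` U ->
  (\forall w \near w0, fiber w `<=` K) ->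
  exists n (phi : 'I_n -> C R -> C R), \forall w \near w0, sheets_at phi w.
Proof.
move=> cK KU fK.
have sep z : U z -> f z != w0 -> \forall z' \near z & w \near w0, f z' <> w.
  move=> Uz fzw; pose e := cabs (f z - w0) / 2.
  have e0 : 0 < e by rewrite divr_gt0// cabs_gt0 subr_eq0.
  have fc := holomorphic_continuous hf Uz.
  exists ([set z' | cabs (f z' - f z) < e], [set w | cabs (w - w0) < e]).
    split; last exact: near_cabs.
    by have /cvgCP := fc; apply.
  move=> [z' w] /= [h1 h2] fz'.
  by rewrite fz' in h1; exact: halfway_disjoint h1 h2.
have [s sE] : exists s : seq (C R), fiber w0 = [set` s].
  apply/finite_seqP.
  suff : finite_set (K `&` fiber w0).
    by apply: sub_finite_set => z zw; split=> //; apply: (nbhs_singleton fK).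
  apply: (@compact_ideal _ K (fun V => finite_set (V `&` fiber w0))) => //.
  - by rewrite set0I.
  - by move=> A B AB; apply: sub_finite_set => z [/AB].
  - by move=> A B fA fB; rewrite setIUl finite_setU.
  move=> z Kz; have Uz := KU z Kz.
  have [fz|fz] := eqVneq (f z) w0.
    have [phi [_ _ phi0 [[V W] /= [zV wW] VW]]] := local_inverse_on Uz.
    exists V => //; apply: (sub_finite_set _ (finite_set1 z)) => y [Vy [_ fy]].
    have W0 : W w0 by apply: nbhs_singleton; rewrite -fz.
    by have /= -> := VW (y, w0) (conj Vy W0) fy; rewrite -fz phi0.
  have [[V W] /= [zV wW] VW] := sep z Uz fz.
  exists V => //; apply: (sub_finite_set _ (@finite_set0 (C R))) => y [Vy [_ fy]].
  have W0 : W w0 by apply: nbhs_singleton.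
  by have /= := VW (y, w0) (conj Vy W0); case.
wlog us : s sE / uniq s.
  move=> /(_ (undup s)); apply; last exact: undup_uniq.
  by rewrite sE; apply/seteqP; split=> z /=; rewrite mem_undup.
have sfib z : z \in s -> fiber w0 z by move=> zs; rewrite sE.
have /choice[phi phiP] : forall z, exists p : C R -> C R, z \in s ->
    [/\ \forall w \near w0, fiber w (p w) /\
          is_derive w (1 : C R) p (derive1 f (p w))^-1,
        {for w0, continuous p}, p w0 = z &
        \forall z' \near z & w \near w0, f z' = w -> z' = p w].
  move=> z; have [zs|zs] := boolP (z \in s); last by exists id.
  have [Uz fz] := sfib z zs.
  by have [phi] := local_inverse_on Uz; rewrite fz => phiP; exists phi.
pose p (i : 'I_(size s)) := nth 0 s i.
have ps i : p i \in s by rewrite mem_nth.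
exists (size s), (fun i => phi (p i)).
have n1 : \forall w \near w0, forall i, fiber w (phi (p i) w) /\
          is_derive w (1 : C R) (phi (p i)) (derive1 f (phi (p i) w))^-1.
  by apply: (@filter_forall _ _ _ (nbhs w0)) => i; have [h _ _ _] := phiP _ (ps i); exact: h.
have n2 : \forall w \near w0, forall i j, phi (p i) w = phi (p j) w -> i = j.
  apply: (@filter_forall _ _ _ (nbhs w0)) => i.
  apply: (@filter_forall _ _ _ (nbhs w0)) => j.
  have [->|ij] := eqVneq i j; first exact: nearW.
  have pij : p i != p j by rewrite nth_uniq.
  pose e := cabs (p i - p j) / 2.
  have e0 : 0 < e by rewrite divr_gt0// cabs_gt0 subr_eq0.
  have [_ ci phi0i _] := phiP _ (ps i); have [_ cj phi0j _] := phiP _ (ps j).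
  have /cvgCP/(_ e e0) hi := ci; have /cvgCP/(_ e e0) hj := cj.
  near=> w => pw.
  have h1 : cabs (phi (p i) w - phi (p i) w0) < e by near: w; exact: hi.
  have h2 : cabs (phi (p j) w - phi (p j) w0) < e by near: w; exact: hj.
  rewrite phi0i in h1; rewrite phi0j -pw in h2.
  by case: (halfway_disjoint h1 h2).
have n3 : \forall w \near w0, K `<=` [set z | f z = w -> exists i, z = phi (p i) w].
  move/compact_near_coveringP : (cK) => /(_ _ _ (fun w z => f z = w ->
    exists i, z = phi (p i) w) (nbhs_filter w0)); apply=> z Kz.
  have Uz := KU z Kz; have [fz|fz] := eqVneq (f z) w0.
    have zs : z \in s by have : fiber w0 z by []; rewrite sE.
    have zi : (index z s < size s)%N by rewrite index_mem.
    have zp : p (Ordinal zi) = z by rewrite /p/= nth_index.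
    have [_ _ _ [[V W] /= VW VWP]] := phiP _ zs.
    exists (V, W) => // -[y w] /= yw fy; exists (Ordinal zi); rewrite zp.
    exact: (VWP (y, w)).
  have [[V W] /= VW VWP] := sep z Uz fz.
  by exists (V, W) => // -[y w] /= yw fy; have := VWP (y, w) yw.
near=> w.
have h1 : forall i, fiber w (phi (p i) w) /\
          is_derive w (1 : C R) (phi (p i)) (derive1 f (phi (p i) w))^-1.
  by near: w; exact: n1.
have h2 : forall i j, phi (p i) w = phi (p j) w -> i = j by near: w; exact: n2.
have h3 : K `<=` [set z | f z = w -> exists i, z = phi (p i) w] by near: w; exact: n3.
have h4 : fiber w `<=` K by near: w; exact: fK.
split.
- by move=> i; have [] := h1 i.
- by move=> i; have [] := h1 i.
- exact: h2.
- by move=> z zw; apply: h3; [exact: h4|case: zw].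
Unshelve. all: by end_near. Qed.

Definition fiber_sum (H : C R -> R) (w : C R) : R := \sum_(z \in fiber w) H z.

Lemma fiber_sumE (H : C R -> R) n (phi : 'I_n -> C R -> C R) (w : C R) :
  sheets_at phi w -> fiber_sum H w = \sum_(i < n) H (phi i w).
Proof.
move=> sw.
have ui : uniq [seq phi i w | i : 'I_n].
  by rewrite map_inj_uniq ?enum_uniq// => i j; exact: sheet_inj sw _ _.
rewrite /fiber_sum (_ : fiber w = [set` [seq phi i w | i : 'I_n]]).
  by rewrite -fsbig_seq// big_map big_enum.
apply/seteqP; split=> z /=.
  by move=> /(sheet_all sw)[i ->]; apply/mapP; exists i; rewrite ?mem_enum.
by move=> /mapP[i _ ->]; exact: sheet_fiber sw i.
Qed.

End Sheets.

(** * Measurable sets of the Hausdorff measure *)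

Section Hausdorff_measure.
Context {R : realType}.
Implicit Types (A B : set (C R)).
Local Open Scope ereal_scope.

Lemma le_diameter A x y : A x -> A y -> (cabs (x - y))%:E <= diameter A.
Proof. by move=> Ax Ay; apply: ereal_sup_ubound; right; exists (x, y). Qed.

Lemma diameter_le A (r : R) : (0 <= r)%R ->
  (forall x y, A x -> A y -> (cabs (x - y) <= r)%R) -> diameter A <= r%:E.
Proof.
move=> r0 Ar; apply: ge_ereal_sup => _ [->|[[x y] [/= Ax Ay] <-]].
  by rewrite lee_fin.
by rewrite lee_fin Ar.
Qed.

Lemma diameterS A B : A `<=` B -> diameter A <= diameter B.
Proof.
move=> AB; apply: ge_ereal_sup => _ [->|[[x y] [/= Ax Ay] <-]].
  exact: diameter_ge0.
by apply: le_diameter; exact: AB.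
Qed.

Lemma hausdorff1_pre_anti (d d' : R) A : (d <= d')%R ->
  hausdorff1_pre d' A <= hausdorff1_pre d A.
Proof.
move=> dd'; apply: ereal_inf_le_tmp => _ [F [AF Fd] <-].
by exists F => //; split=> // k; rewrite (le_trans (Fd k))// lee_fin.
Qed.

(** A cover by sets of diameter less than the distance of [A] to [B] splits into
    a cover of [A] and a cover of [B]. *)
Lemma hausdorff1_pre_separated (d e : R) A B : (e < d)%R ->
  (forall x y, A x -> B y -> (d <= cabs (x - y))%R) ->
  hausdorff1_pre e A + hausdorff1_pre e B <= hausdorff1_pre e (A `|` B).
Proof.
move=> ed AB; apply: le_ereal_inf_tmp => _ [F [ABF Fe] <-].
apply: (@le_trans _ _ (\sum_(k <oo) diameter (F k `&` A) +
                       \sum_(k <oo) diameter (F k `&` B))).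
  apply: leeD; apply: ereal_inf_lbound.
    exists (fun k => F k `&` A) => //; split=> [x Ax|k].
      by have [k _ Fk] := ABF x (or_introl Ax); exists k.
    exact: (le_trans (diameterS (@subIsetl _ _ _)) (Fe k)).
  exists (fun k => F k `&` B) => //; split=> [x Bx|k].
    by have [k _ Fk] := ABF x (or_intror Bx); exists k.
  exact: (le_trans (diameterS (@subIsetl _ _ _)) (Fe k)).
rewrite -nneseriesD; try by move=> *; exact: diameter_ge0.
apply: lee_nneseries => k *; first by rewrite adde_ge0// diameter_ge0.
have [[x [Fx Ax]]|] := pselect (F k `&` A !=set0); last first.
  by move=> /set0P/negP/negPn/eqP ->; rewrite diameter0 add0e diameterS//; exact: subIsetl.
have [[y [Fy By]]|] := pselect (F k `&` B !=set0); last first.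
  by move=> /set0P/negP/negPn/eqP ->; rewrite diameter0 adde0 diameterS//; exact: subIsetl.
have := le_trans (le_diameter Fx Fy) (Fe k); rewrite lee_fin => xye.
by have := lt_le_trans ed (AB _ _ Ax By); rewrite ltNge xye.
Qed.

(** The supremum over the mesh commutes with the sum because the mesh of both covers
    can be decreased at the same time. *)
Lemma hausdorff1_separated (d : R) A B : (0 < d)%R ->
  (forall x y, A x -> B y -> (d <= cabs (x - y))%R) ->
  hausdorff1 A + hausdorff1 B <= hausdorff1 (A `|` B).
Proof.
move=> d0 AB; set X := hausdorff1 (A `|` B).
have [->|Xoo] := eqVneq X +oo; first by rewrite leey.
have X0 : 0 <= X by exact: hausdorff1_ge0.
have Xfin : X \is a fin_num by rewrite ge0_fin_numE// ltey.
have key d1 d2 : (0 < d1)%R -> (0 < d2)%R ->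
    hausdorff1_pre d1 A + hausdorff1_pre d2 B <= X.
  move=> d10 d20; pose e := (Num.min (Num.min d1 d2) (d / 2))%R.
  have e0 : (0 < e)%R by rewrite !lt_min d10 d20 divr_gt0.
  have ed : (e < d)%R by rewrite !gt_min; apply/orP; right; lra.
  apply: le_trans (hausdorff1_ge_pre (A `|` B) e0).
  apply: le_trans (hausdorff1_pre_separated ed AB).
  by apply: leeD; apply: hausdorff1_pre_anti; rewrite !ge_min lexx ?orbT.
have hAX : hausdorff1 A <= X by apply: le_hausdorff1; exact: subsetUl.
have hAfin : hausdorff1 A \is a fin_num.
  by rewrite ge0_fin_numE ?hausdorff1_ge0// (le_lt_trans hAX)// ltey.
rewrite addeC -leeBrDr//; apply: ge_ereal_sup => _ [d2 d20 <-].
have B2X : hausdorff1_pre d2 B <= X.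
  apply: le_trans (hausdorff1_ge_pre B d20) _.
  by apply: le_hausdorff1; exact: subsetUr.
have B2fin : hausdorff1_pre d2 B \is a fin_num.
  by rewrite ge0_fin_numE ?hausdorff1_pre_ge0// (le_lt_trans B2X)// ltey.
rewrite leeBrDr// addeC -leeBrDr//; apply: ge_ereal_sup => _ [d1 d10 <-].
by rewrite leeBrDr//; exact: key.
Qed.

Lemma sum_even_odd (a : nat -> \bar R) N : (forall k, 0 <= a k) ->
  \sum_(0 <= k < N.*2) a k =
  \sum_(0 <= k < N) a k.*2 + \sum_(0 <= k < N) a k.*2.+1.
Proof.
move=> a0; elim: N => [|N IH]; first by rewrite !big_geq// adde0.
by rewrite doubleS !big_nat_recr//= IH addeACA addeA.
Qed.

(** Caratheodory's criterion for metric outer measures.  The layers [D k] of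
    points of [X] at distance between [1 / (k + 2)] and [1 / (k + 1)] of the
    closed set are separated from each other when their indices differ by at least
    two, so the sum of their measures is at most twice the measure of [X]. *)
Lemma closed_hausdorff1_measurable (F : set (C R)) : closed F ->
  caratheodory_measurable (@hausdorff1_outer R) F.
Proof.
move=> cF; apply: le_caratheodory_measurable => X.
rewrite -![hausdorff1_outer R _]/(hausdorff1 _).
have [->|Xoo] := eqVneq (hausdorff1 X) +oo; first by rewrite leey.
pose r n : R := (n.+1%:R^-1)%R.
pose A n := X `&` [set z | forall k, F k -> (r n <= cabs (z - k))%R].
pose D n := A n.+1 `\` A n.
have rS n m : (n <= m)%N -> (r m <= r n)%R.
  by move=> nm; rewrite lef_pV2 ?posrE// ler_nat ltnS.
have rlt n m : (n < m)%N -> (r m < r n)%R.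
  by move=> nm; rewrite ltf_pV2 ?posrE// ltr_nat ltnS.
have r0 n : (0 < r n)%R by rewrite invr_gt0.
have AS n m : (n <= m)%N -> A n `<=` A m.
  by move=> nm z [Xz zA]; split=> // k Fk; rewrite (le_trans (rS _ _ nm)) ?zA.
have AD m j : (m < j)%N -> forall x y, A m x -> D j y -> (r m - r j <= cabs (x - y))%R.
  move=> mj x y [Xx xA] [[Xy _] yA].
  have [k [Fk yk]] : exists k, F k /\ (cabs (y - k) < r j)%R.
    apply: contrapT => /forallNP H; apply: yA; split=> // k Fk.
    by rewrite leNgt; apply/negP => yk; exact: (H k).
  by have := xA k Fk; have := cabs_sub x k y; lra.
have DA n : D n `<=` A n.+1 by move=> z [].
have hD0 k : 0 <= hausdorff1 (D k) by exact: hausdorff1_ge0.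
(* Layers with indices of the same parity [c] are pairwise separated, hence the sum
   of their measures is the measure of their union. *)
have halfsum (c N : nat) : exists B, [/\ B `<=` X,
    \sum_(0 <= k < N) hausdorff1 (D (k.*2 + c)%N) <= hausdorff1 B &
    forall j, (N.*2 + c <= j)%N ->
      exists2 d : R, (0 < d)%R & forall x y, B x -> D j y -> (d <= cabs (x - y))%R].
  elim: N => [|N [B [BX IH Bsep]]].
    exists set0; split=> //; first by rewrite big_geq// hausdorff1_ge0.
    by exists 1%R.
  exists (B `|` D (N.*2 + c)%N); split.
  - by move=> z [/BX//|[[]]].
  - have [d d0 dP] := Bsep _ (leqnn _).
    rewrite big_nat_recr//= (le_trans _ (hausdorff1_separated d0 dP))//.
    exact: leeD2r.
  - move=> j; rewrite doubleS !addSn => Nj.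
    have [|d d0 dP] := Bsep j; first exact: ltnW (ltnW Nj).
    exists (Num.min d (r (N.*2 + c).+1 - r j))%R.
      by rewrite lt_min d0 subr_gt0 rlt.
    move=> x y [Bx|Dx] Dy; rewrite ge_min; apply/orP; [left|right].
      exact: dP.
    by apply: AD Dy => //; exact: DA.
have Dsum : \sum_(0 <= k <oo) hausdorff1 (D k) < +oo.
  apply: (@le_lt_trans _ _ (hausdorff1 X + hausdorff1 X)); last first.
    by rewrite lte_add_pinfty// ltey.
  apply: lime_le; first by apply: is_cvg_nneseries => *; exact: hausdorff1_ge0.
  apply: nearW => N.
  apply: (@le_trans _ _ (\sum_(0 <= k < N.*2) hausdorff1 (D k))).
    by apply: lee_sum_nneg_natr => // ; rewrite -addnn leq_addr.
  rewrite sum_even_odd//; apply: leeD.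
    have [B [BX sB _]] := halfsum 0%N N.
    under eq_bigr do rewrite -(addn0 _.*2).
    by rewrite (le_trans sB)// le_hausdorff1.
  have [B [BX sB _]] := halfsum 1%N N.
  under eq_bigr do rewrite -(addn1 _.*2).
  by rewrite (le_trans sB)// le_hausdorff1.
have sepFA n : hausdorff1 (X `&` F) + hausdorff1 (A n) <= hausdorff1 X.
  apply: (@le_trans _ _ (hausdorff1 ((X `&` F) `|` A n))).
    apply: (hausdorff1_separated (r0 n)) => x y [_ Fx] [_ yA].
    by rewrite cabsB yA.
  by apply: le_hausdorff1 => z [[]|[]].
have coverA n : X `&` ~` F `<=` A n `|` \bigcup_k D (k + n)%N.
  move=> z [Xz nFz].
  have [m Am] : exists m, A m z.
    have : nbhs z (~` F) by apply: open_nbhs_nbhs; split=> //; exact: closed_openC.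
    move=> /nbhsCP[e e0 eF]; have [m me] := ltr_add_invr e0.
    exists m; split=> // k Fk; rewrite leNgt; apply/negP => zk.
    apply: (eF k) => //; rewrite cabsB (lt_trans zk)//.
    by rewrite add0r in me.
  elim: m Am => [|m IH] Am; first by left; exact: AS Am.
  have [Am'|nAm] := pselect (A m z); first exact: IH.
  have [mn|nm] := ltnP m n; first by left; exact: AS Am.
  by right; exists (m - n)%N => //; rewrite subnK.
have := nneseries_tail_cvg Dsum (fun k _ => hD0 k) => tail0.
apply/lee_addgt0Pr => e e0.
have : \forall n \near \oo, \sum_(n <= k <oo) hausdorff1 (D k) < e%:E.
  move/fine_cvgP : tail0 => [fin /cvgrPdist_lt/(_ e e0) tail0].
  near=> n.
  have tf : \sum_(n <= k <oo) hausdorff1 (D k) \is a fin_num by near: n.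
  rewrite -(fineK tf) lte_fin.
  have : (`|0 - fine (\sum_(n <= k <oo) hausdorff1 (D k))| < e)%R by near: n.
  by rewrite sub0r normrN; exact: le_lt_trans (ler_norm _).
move=> [n _ /(_ n (leqnn n))] tn.
have hcover : hausdorff1 (X `&` ~` F) <= hausdorff1 (A n) + e%:E.
  apply: (le_trans (le_hausdorff1 (@coverA n))).
  apply: (le_trans (outer_measureU2 (@hausdorff1_outer R) _ _)).
  apply: leeD => //; apply: (le_trans (@hausdorff1_sigma_subadditive R _)).
  apply: le_trans (ltW tn).
  by rewrite -(nneseries_addn n hD0).
by rewrite (le_trans (leeD2l _ hcover))// addeA leeD2r.
Unshelve. all: by end_near. Qed.

End Hausdorff_measure.

Section Plane_measurability.
Context {R : realType}.
Implicit Types (E U : set (C R)).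

Local Notation plane := (caratheodory_type (@hausdorff1_outer R)).

Lemma closed_measurable_plane (F : set (C R)) : closed F -> measurable (F : set plane).
Proof. exact: closed_hausdorff1_measurable. Qed.

Lemma open_measurable_plane (V : set (C R)) : open V -> measurable (V : set plane).
Proof.
move=> oV; rewrite -[V]setCK; apply: (@measurableC _ plane).
by apply: closed_measurable_plane; exact: open_closedC.
Qed.

Lemma compact_closed_plane (K : set (C R)) : compact K -> closed K.
Proof. by apply: compact_closed; exact: norm_hausdorff. Qed.

Lemma open_preimage_plane (T : topologicalType) U (H : C R -> T) (V : set T) : open U ->
  (forall z, U z -> {for z, continuous H}) -> open V -> open (U `&` H @^-1` V).
Proof.
move=> oU cH oV; rewrite openE => z [Uz Vz].
apply: filterI; first exact: open_nbhs_nbhs.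
by apply: cH => //; exact: open_nbhs_nbhs.
Qed.

Lemma continuous_measurable_plane E U (H : C R -> R) : measurable (E : set plane) ->
  open U -> E `<=` U -> (forall z, U z -> {for z, continuous H}) ->
  measurable_fun (E : set plane) H.
Proof.
move=> mE oU EU cH; apply: (measurability _ (measurable_realfun.RGenOpens.measurableE R)).
move=> _ [_ [x [y ->] <-]].
rewrite (_ : E `&` _ = E `&` (U `&` H @^-1` `]x, y[)); last first.
  by apply/seteqP; split=> z [Ez]; [split=> //; split=> //; exact: EU|case].
apply: (@measurableI _ plane) => //; apply: open_measurable_plane.
by apply: open_preimage_plane => //; exact: interval_open.
Qed.

Lemma itvco_bigcup (x y : R) : `[x, y[%classic = \bigcup_n `[x, y - n.+1%:R^-1]%classic.
Proof.
apply/seteqP; split=> s /=; rewrite in_itv/=.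
  move=> /andP[xs sy]; have [n sn] := ltr_add_invr sy.
  by exists n => //=; rewrite in_itv/= xs lerBrDr ltW.
move=> [n _ /=]; rewrite in_itv/= => /andP[-> sn]/=.
by rewrite (le_lt_trans sn)// ltrBlDr ltrDl.
Qed.

Lemma arc_compact (c : R -> C R) (x y : R) :
  (forall s, x <= s <= y -> {for s, continuous c}) -> compact (c @` `[x, y]).
Proof.
move=> cc; apply: continuous_compact; last exact: segment_compact.
apply: continuous_in_subspaceT => s; rewrite inE/= in_itv/=; exact: cc.
Qed.

(** The arc is a countable union of compact arcs. *)
Lemma arc_measurable (c : R -> C R) (x y : R) :
  (forall s, x <= s <= y -> {for s, continuous c}) ->
  measurable (c @` `[x, y[ : set plane).
Proof.
move=> cc; rewrite itvco_bigcup image_bigcup.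
apply: (@bigcup_measurable _ plane) => n _; apply: closed_measurable_plane.
apply: compact_closed_plane; apply: arc_compact => s /andP[xs sy].
by apply: cc; rewrite xs (le_trans sy)// gerBl.
Qed.

End Plane_measurability.

(** * Lengths of short arcs *)

Section Length_of_arcs.
Context {R : realType}.

Lemma subdivision (x h : R) n s : x <= s < x + n%:R * h ->
  exists2 k, (k < n)%N & x + k%:R * h <= s < x + k.+1%:R * h.
Proof.
elim: n => [|n IH]; first by rewrite mul0r addr0 leNgt => /andP[/negbTE ->].
move=> /andP[xs sn]; have [sn'|sn'] := ltP s (x + n%:R * h).
  have [|k kn ks] := IH; first by rewrite xs.
  by exists k => //; rewrite ltnW.
by exists n => //; rewrite sn'.
Qed.

(** The images of the pieces of a regular subdivision of the interval form a cover
    of arbitrarily small mesh. *)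
Lemma hausdorff1_lipschitz (c : R -> C R) (x y L : R) : x <= y -> 0 <= L ->
  (forall s s', x <= s < y -> x <= s' < y -> cabs (c s - c s') <= L * `|s - s'|) ->
  (hausdorff1 (c @` `[x, y[) <= (L * (y - x))%:E)%E.
Proof.
move=> xy L0 cL; apply: ge_ereal_sup => _ [d /= d0 <-].
have [N HN] : exists N, L * (y - x) / N.+1%:R <= d.
  have [N HN] := ltr_add_invr (divr_gt0 d0 (ltr_wpDl (mulr_ge0 L0 (eqbRL (subr_ge0 _ _) xy)) (@ltr01 R))).
  exists N; move: HN; rewrite add0r ltr_pdivlMr ?ltr_wpDl// ?mulr_ge0 ?subr_ge0// => /ltW.
  apply: le_trans; rewrite mulrC ler_wpM2l ?invr_ge0// lerDl//.
pose h := (y - x) / N.+1%:R.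
have h0 : 0 <= h by rewrite divr_ge0// subr_ge0.
have Nh : N.+1%:R * h = y - x by rewrite /h mulrC divfK.
have LhE : L * h = L * (y - x) / N.+1%:R by rewrite /h mulrA.
clearbody h.
pose J k := `[x, y[ `&` `[x + k%:R * h, x + k.+1%:R * h[%classic.
pose F k := if (k < N.+1)%N then c @` (J k) else set0.
have Fdiam k : (diameter (F k) <= (if (k < N.+1)%N then L * h else 0)%:E)%E.
  rewrite /F; case: ifP => _; last by rewrite diameter0.
  apply: diameter_le; first by rewrite mulr_ge0.
  move=> _ _ [s [/= + +] <-] [s' [/= + +] <-]; rewrite !in_itv/= => sx sk s'x s'k.
  rewrite (le_trans (cL _ _ sx s'x))// ler_wpM2l// ler_norml.
  by move: sk s'k; rewrite -natr1 mulrDl mul1r; lra.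
have sumF n : (\sum_(0 <= k < n) diameter (F k) <= ((minn n N.+1)%:R * (L * h))%:E)%E.
  elim: n => [|n IH]; first by rewrite big_geq// min0n mul0r.
  rewrite big_nat_recr//= (le_trans (leeD IH (Fdiam n)))// -EFinD lee_fin.
  case: ifP => [nN|/negbT nN].
    by rewrite (minn_idPl nN) (minn_idPl (ltnW nN)) -natr1 mulrDl mul1r.
  by rewrite -leqNgt in nN; rewrite addr0 (minn_idPr nN) (minn_idPr (leqW nN)).
apply: (@le_trans _ _ (\sum_(k <oo) diameter (F k))%E).
  apply: ereal_inf_lbound; exists F => //; split=> [_ [s /= sxy <-]|k].
    have [|k kN ks] := @subdivision x h N.+1 s; first by rewrite Nh subrKC; rewrite in_itv/= in sxy.
    by exists k => //; rewrite /F kN; exists s => //; split=> //=; rewrite in_itv.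
  rewrite (le_trans (Fdiam k))// lee_fin; case: ifP => _; last exact: ltW.
  by rewrite LhE.
apply: lime_le; first by apply: is_cvg_nneseries => *; exact: diameter_ge0.
apply: nearW => n; rewrite (le_trans (sumF n))// lee_fin -Nh [leRHS]mulrCA ler_wpM2r ?mulr_ge0//.
by rewrite ler_nat geq_minr.
Qed.

(** A map to the line that does not increase distances turns a cover of a set
    into a cover of its image by intervals that are no longer than the diameters. *)
Lemma hausdorff1_projection (B : set (C R)) (p : C R -> R) (u v : R) :
  (forall z w, `|p z - p w| <= cabs (z - w)) -> u <= v -> `[u, v[ `<=` p @` B ->
  ((v - u)%:E <= hausdorff1 B)%E.
Proof.
move=> plip uv pB; apply: le_trans (hausdorff1_ge_pre B (@ltr01 R)).
apply: le_ereal_inf_tmp => _ [F [BF F1] <-].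
have Ffin k : diameter (F k) \is a fin_num.
  by rewrite ge0_fin_numE ?diameter_ge0// (le_lt_trans (F1 k))// ltry.
pose l k := fine (diameter (F k)).
have l0 k : 0 <= l k by rewrite fine_ge0// diameter_ge0.
pose m k := inf (p @` F k).
have FI k z : F k z -> m k <= p z <= m k + l k.
  move=> Fz.
  have lbF w : F k w -> p z - l k <= p w.
    move=> Fw; have := le_diameter Fz Fw; rewrite -(fineK (Ffin k)) lee_fin -/(l k) => h.
    by have := le_trans (le_trans (ler_norm _) (plip z w)) h; lra.
  have nF : (p @` F k) !=set0 by exists (p z); exists z.
  have lb : has_lbound (p @` F k).
    by exists (p z - l k) => _ [w Fw <-]; exact: lbF.
  apply/andP; split; first by apply: ge_inf => //; exists z.
  rewrite -lerBlDr; apply: lb_le_inf => // _ [w Fw <-]; exact: lbF.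
have -> : (v - u)%:E = lebesgue_measure (`[u, v[ : set R).
  rewrite lebesgue_measure_itv/= lte_fin; case: ltP => // vu.
  by rewrite (le_anti (introT andP (conj uv vu))) subrr.
have cov : `[u, v[%classic `<=` \bigcup_k `[m k, m k + l k]%classic.
  move=> s /pB[z Bz <-]; have [k _ Fz] := BF _ Bz.
  by exists k => //=; rewrite in_itv/=; exact: FI.
have mI k : measurable `[m k, m k + l k]%classic by exact: measurable_itv.
have mJ : measurable `[u, v[%classic by exact: measurable_itv.
apply: (le_trans (measure_sigma_subadditive lebesgue_measure mI mJ cov)).
apply: lee_nneseries => // k _.
rewrite [X in (X <= _)%E](lebesgue_measure_itv `[m k, m k + l k]%R)/= lte_fin.
case: ltP => _; last exact: diameter_ge0.
by rewrite -(fineK (Ffin k)) -EFinB lee_fin -/(l k) addrC addKr.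
Qed.

(** The length of a short arc: the arc is nearly the graph of an affine map, which
    bounds its length from above; from below it is bounded by that of its
    projection to the tangent. *)
Lemma hausdorff1_short_arc (c dc : R -> C R) (s0 e : R) : 0 < e ->
  (\forall s \near s0, is_curve_derive c s (dc s)) -> {for s0, continuous dc} ->
  exists2 d : R, 0 < d & forall x y, s0 - d < x -> x <= y -> y < s0 + d ->
    (((cabs (dc s0) - e) * (y - x))%:E <= hausdorff1 (c @` `[x, y[) <=
     ((cabs (dc s0) + e) * (y - x))%:E)%E.
Proof.
move=> e0 /nbhs_ballP[d1 /= d10 d1P] /cvgCP/(_ e e0)/nbhs_ballP[d2 /= d20 d2P].
pose v := dc s0; pose d := Num.min d1 d2.
have d0 : 0 < d by rewrite lt_min d10.
have cD s : `|s - s0| < d -> is_curve_derive c s (dc s).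
  by rewrite lt_min => /andP[h _]; apply: d1P; rewrite /ball/= distrC.
have dcv s : `|s - s0| < d -> cabs (dc s - v) <= e.
  by rewrite lt_min => /andP[_ h]; apply/ltW/d2P; rewrite /ball/= distrC.
have inc x y : s0 - d < x -> y < s0 + d -> forall s, x <= s <= y -> `|s - s0| < d.
  by move=> xd yd s /andP[xs sy]; rewrite ltr_norml; apply/andP; split; lra.
have aff s s' : `|s - s0| < d -> `|s' - s0| < d -> s <= s' ->
    cabs (c s' - c s - v * toC (s' - s)) <= e * (s' - s).
  move=> sd s'd ss'; have I r : s <= r <= s' -> `|r - s0| < d.
    by apply: inc; move: sd s'd; rewrite !ltr_norml => /andP[? ?] /andP[? ?]; lra.
  by apply: (curve_mean_value ss' (fun r rI => cD r (I r rI))) => r /I/dcv.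
exists d => // x y xd xy yd; have I := inc _ _ xd yd; apply/andP; split; last first.
  apply: hausdorff1_lipschitz => //; first by rewrite addr_ge0 ?cabs_ge0// ltW.
  move=> s s' /andP[xs sy] /andP[xs' s'y].
  wlog ss' : s s' xs sy xs' s'y / s <= s'.
    move=> H; have [ss'|/ltW s's] := leP s s'; first exact: H.
    by rewrite cabsB distrC; exact: H.
  have h := aff s s' (I s _) (I s' _) ss'.
  rewrite cabsB distrC ger0_norm ?subr_ge0//.
  rewrite -[X in cabs X](subrK (v * toC (s' - s))) (le_trans (cabsD _ _))//.
  rewrite cabsM cabs_toC ger0_norm ?subr_ge0// mulrDl addrC lerD2l h//.
    by rewrite xs ltW.
  by rewrite xs' ltW.
have [ve|ev] := ltP (cabs v) e.
  apply: le_trans (hausdorff1_ge0 _); rewrite lee_fin mulr_le0_ge0 ?subr_ge0//.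
  by rewrite subr_le0 ltW.
have vp : 0 < cabs v by rewrite (lt_le_trans e0).
pose p z := complex.Re (v^* * z) / cabs v.
have plip z w : `|p z - p w| <= cabs (z - w).
  have -> : p z - p w = complex.Re (v^* * (z - w)) / cabs v.
    by rewrite /p !ReImE; ring.
  rewrite normrM normfV (ger0_norm (cabs_ge0 v)) ler_pdivrMr//.
  by rewrite (le_trans (Re_le_cabs _))// cabsM cabsJ mulrC.
set a := p (c x); pose b := a + (cabs v - e) * (y - x).
have -> : (cabs v - e) * (y - x) = b - a by rewrite /b [RHS]addrC addKr.
have pcy : b <= p (c y).
  have h := aff x y (I x _) (I y _) xy.
  have : `|p (c y - c x) - p (v * toC (y - x))| <= e * (y - x).
    by apply: le_trans (plip _ _) _; apply: h; rewrite ?lexx ?xy.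
  have -> : p (c y - c x) = p (c y) - a by rewrite /a /p !ReImE; ring.
  have -> : p (v * toC (y - x)) = cabs v * (y - x).
    rewrite /p !ReImE/= !mulr0 subr0 add0r mulNr opprK !mulrA -mulrDl -!expr2.
    by rewrite -cabs_sqr mulrAC expr2 mulfK// lt0r_neq0.
  by rewrite ler_norml /b => /andP[+ _]; lra.
apply: (hausdorff1_projection plip); first by rewrite /b lerDl mulr_ge0 ?subr_ge0.
move=> r /=; rewrite in_itv/= => /andP[ar rb].
have pc : {within `[x, y], continuous (p \o c)}.
  apply: continuous_in_subspaceT => s; rewrite inE/= in_itv/= => sxy.
  have cs := curve_derive_continuous (cD s (I s sxy)).
  apply: cvgMl; apply: (@continuous_comp _ _ _ (fun s => v^* * c s)).
    by apply: cvgM; [exact: cvg_cst|exact: cs].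
  exact: Re_continuous.
have [|s] := @IVT _ (p \o c) x y r xy pc.
  by rewrite ge_min le_max /= -/a ar (ltW (lt_le_trans rb pcy)) orbT.
rewrite in_itv/= => /andP[xs sy] psr; exists (c s) => //; exists s => //=.
rewrite in_itv/= xs lt_neqAle sy andbT; apply/eqP => sE.
by move: (lt_le_trans rb pcy); rewrite -psr /= sE ltxx.
Qed.

End Length_of_arcs.

Section Arc_integral.
Context {R : realType}.

(** On a short arc the integrand is nearly constant and the length is nearly the
    speed times the parameter increment. *)
Lemma integral_short_arc (U : set (C R)) (H : C R -> R) (c dc : R -> C R) (s0 e : R) :
  open U -> (forall z, U z -> {for z, continuous H}) ->
  (\forall s \near s0, is_curve_derive c s (dc s) /\ U (c s)) ->
  {for s0, continuous dc} -> 0 < e ->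
  \forall x \near s0 & y \near s0, x <= y ->
    forall A, A = c @` `[x, y[ ->
    [/\ measurable (A : set (caratheodory_type (@hausdorff1_outer R))),
        A `<=` U, (hausdorff1 A < +oo)%E,
        (arc_length R).-integrable A (EFin \o H) &
        `|\int[arc_length R]_(z in A) H z - H (c s0) * cabs (dc s0) * (y - x)|
          <= e * (y - x)].
Proof.
move=> oU cH cU dcc e0.
set H0 := H (c s0); set V := cabs (dc s0).
have V0 : 0 <= V by exact: cabs_ge0.
have W0 : 0 < V + 1 + `|H0| by rewrite ltr_wpDr// ltr_wpDl.
have [e1 [e10 e11 e1e]] : exists e1, [/\ 0 < e1, e1 <= 1 & e1 * (V + 1 + `|H0|) <= e].
  exists (Num.min 1 (e / (V + 1 + `|H0|))); split.
  - by rewrite lt_min ltr01 divr_gt0.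
  - by rewrite ge_min lexx.
  - by rewrite -ler_pdivlMr// ge_min lexx orbT.
have [Dc Uc] : (\forall s \near s0, is_curve_derive c s (dc s)) /\
    (\forall s \near s0, U (c s)) by split; apply: filterS cU => s [].
have [d1 d10 d1P] := hausdorff1_short_arc e10 Dc dcc.
have cc : {for s0, continuous c}.
  exact: curve_derive_continuous (nbhs_singleton Dc).
have Hc : \forall s \near s0, `|H (c s) - H0| < e1.
  have : {for s0, continuous (H \o c)}.
    apply: continuous_comp; [exact: cc|apply: cH; exact: nbhs_singleton Uc].
  by move=> /cvgRP/(_ e1 e10).
have [d2 /= d20 d2P] : exists2 d2 : R, 0 < d2 & forall s, `|s - s0| < d2 ->
    [/\ `|H (c s) - H0| < e1, U (c s) & is_curve_derive c s (dc s)].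
  have /nbhs_ballP[d2 /= d20 d2P] : \forall s \near s0,
      [/\ `|H (c s) - H0| < e1, U (c s) & is_curve_derive c s (dc s)].
    by apply: filterS3 Hc Uc Dc => s ? ? ?; split.
  by exists d2 => // s sd2; apply: d2P; rewrite /ball/= distrC.
pose d := Num.min d1 d2; have d0 : 0 < d by rewrite lt_min d10.
exists ([set x | `|s0 - x| < d], [set x | `|s0 - x| < d]).
  by split; apply/nbhs_ballP; exists d.
move=> [x y] /= [xd yd] xy A AE.
have I s : x <= s <= y -> `|s - s0| < d.
  by move=> /andP[xs sy]; move: xd yd; rewrite !ltr_norml => /andP[? ?] /andP[? ?];
     apply/andP; split; lra.
have I2 s : x <= s <= y -> [/\ `|H (c s) - H0| < e1, U (c s) & is_curve_derive c s (dc s)].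
  by move=> /I; rewrite lt_min => /andP[_ h]; exact: d2P.
have AU : A `<=` U.
  rewrite AE => _ [s /= + <-]; rewrite in_itv/= => /andP[xs sy].
  by have [|_ h _] := I2 s; [rewrite xs ltW|exact: h].
have AH z : A z -> `|H z - H0| <= e1.
  rewrite AE => -[s /= + <-]; rewrite in_itv/= => /andP[xs sy].
  by have [|/ltW h _ _] := I2 s; [rewrite xs ltW|exact: h].
have mA : measurable (A : set (caratheodory_type (@hausdorff1_outer R))).
  by rewrite AE; apply: arc_measurable => s /I2[_ _]; exact: curve_derive_continuous.
have mH : measurable_fun (A : set (caratheodory_type (@hausdorff1_outer R))) H.
  exact: continuous_measurable_plane oU AU cH.
have /andP[lA uA] : (((V - e1) * (y - x))%:E <= hausdorff1 A <= ((V + e1) * (y - x))%:E)%E.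
  have xI := I x; have yI := I y; rewrite !lexx xy in xI yI.
  move: (xI isT) (yI isT); rewrite !lt_min => /andP[+ _] /andP[+ _].
  rewrite !ltr_norml => /andP[? ?] /andP[? ?].
  by rewrite AE; apply: d1P => //; lra.
have Aoo : (hausdorff1 A < +oo)%E by rewrite (le_lt_trans uA)// ltry.
have iH : (arc_length R).-integrable A (EFin \o H).
  apply: measurable_bounded_integrable => //.
  exists (`|H0| + e1); split; first exact: num_real.
  move=> M HM z Az /=; rewrite (le_trans _ (ltW HM))//.
  by have := ler_normD (H z - H0) H0; rewrite subrK; have := AH z Az; lra.
split=> //.
pose m := fine (hausdorff1 A).
have Afin : hausdorff1 A \is a fin_num by rewrite ge0_fin_numE ?hausdorff1_ge0.
have lm : (V - e1) * (y - x) <= m by rewrite -lee_fin fineK.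
have um : m <= (V + e1) * (y - x) by rewrite -lee_fin fineK.
have m0 : 0 <= m by rewrite fine_ge0// hausdorff1_ge0.
have icst r : (arc_length R).-integrable A (EFin \o (cst r)).
  apply: measurable_bounded_integrable => //.
  exists `|r|; split; first exact: num_real.
  by move=> M HM z Az /=; rewrite ltW.
have Icst r : \int[arc_length R]_(z in A) (cst r z) = r * m.
  by rewrite Rintegral_cst.
have uI : \int[arc_length R]_(z in A) H z <= (H0 + e1) * m.
  rewrite -Icst; apply: le_Rintegral => // z Az.
  by have := AH z Az; rewrite ler_norml => /andP[? ?]; rewrite /cst; lra.
have lI : (H0 - e1) * m <= \int[arc_length R]_(z in A) H z.
  rewrite -Icst; apply: le_Rintegral => // z Az.
  by have := AH z Az; rewrite ler_norml => /andP[? ?]; rewrite /cst; lra.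
set J := \int[arc_length R]_(z in A) H z in uI lI *.
have h1 : `|J - H0 * m| <= e1 * m by rewrite ler_norml; apply/andP; split; lra.
have h2 : `|H0 * (m - V * (y - x))| <= `|H0| * (e1 * (y - x)).
  by rewrite normrM ler_wpM2l// ler_norml; apply/andP; split; lra.
have -> : J - H0 * V * (y - x) = (J - H0 * m) + H0 * (m - V * (y - x)) by ring.
rewrite (le_trans (ler_normD _ _))// (le_trans (lerD h1 h2))//.
have yx : 0 <= y - x by rewrite subr_ge0.
apply: (@le_trans _ _ (e1 * (V + 1 + `|H0|) * (y - x))); last by rewrite ler_wpM2r.
have : e1 * m <= e1 * ((V + 1) * (y - x)).
  rewrite ler_wpM2l ?(ltW e10)// (le_trans um)// ler_wpM2r// lerD2l//.
by lra.
Qed.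

End Arc_integral.

(** * Polar coordinates *)

Section Polar_coordinates.
Context {R : realType}.

Definition polar (t s : R) : C R := (expR t * cos s +i* (expR t * sin s))%C.

Lemma cabs_polar t s : cabs (polar t s) = expR t.
Proof.
rewrite /cabs /= !exprMn -mulrDr cos2Dsin2 mulr1 sqrtr_sqr ger0_norm ?expR_ge0//.
Qed.

Lemma polarD2pi t s : polar t (s + pi *+ 2) = polar t s.
Proof. by rewrite /polar sinD2pi cosD2pi. Qed.

(** The cosine of the difference of the angles is [1], and a sine does not vanish
    strictly between [0] and [pi]. *)
Lemma polar_inj t s s' : `|s - s'| < pi *+ 2 -> polar t s = polar t s' -> s = s'.
Proof.
wlog ss' : s s' / s' <= s.
  move=> W sp ps; have [|/ltW] := leP s' s; first by move=> h; exact: W.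
  by move=> h; apply/esym; apply: W; rewrite // distrC.
rewrite ger0_norm ?subr_ge0// => sp [/(mulfI (lt0r_neq0 (expR_gt0 t))) pc
  /(mulfI (lt0r_neq0 (expR_gt0 t))) ps].
have c1 : cos (s - s') = 1 by rewrite cosB pc ps -!expr2 cos2Dsin2.
apply/eqP; rewrite -subr_eq0; apply/eqP; pose h := (s - s') / 2.
have hE : s - s' = h *+ 2 by rewrite /h mulr2n -splitr.
rewrite hE; have h0 : 0 <= h by rewrite divr_ge0// subr_ge0.
have hpi : h < pi by move: sp; rewrite hE ltr_pMn2r.
move: c1; rewrite hE cos_mulr2n => c1.
have sh : sin h = 0.
  by apply/eqP; rewrite -sqrf_eq0 sin2cos2; apply/eqP; lra.
have [->|hn0] := eqVneq h 0; first by rewrite mul0rn.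
have : 0 < sin h by apply: sin_gt0_pi; rewrite hpi lt_def hn0 h0.
by rewrite sh ltxx.
Qed.

Lemma polar_surj t (w : C R) : cabs w = expR t ->
  exists2 s, 0 <= s < pi *+ 2 & w = polar t s.
Proof.
move=> wt; have et : expR t != 0 :> R by rewrite lt0r_neq0// expR_gt0.
pose x := complex.Re w / expR t; pose y := complex.Im w / expR t.
have xy1 : x ^+ 2 + y ^+ 2 = 1.
  rewrite /x /y !expr_div_n -mulrDl -cabs_sqr wt divff// expf_neq0//.
have x1 : -1 <= x <= 1.
  by have y2 := sqr_ge0 y; apply/andP; split; nra.
have sE : sin (acos x) = `|y|.
  by rewrite sin_acos// -sqrtr_sqr; congr Num.sqrt; lra.
have pp : 0 < pi :> R by exact: pi_gt0.
(* The angle is at most [pi] in the upper half-plane; the lower half-plane is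
   reached by symmetry. *)
have [y0|y0] := leP 0 y.
  exists (acos x).
    rewrite acos_ge0//= (le_lt_trans (acos_lepi x1))// mulr2n ltrDl//.
  rewrite /polar acosK ?in_itv// sE ger0_norm//.
  by apply: complex_ext => /=; rewrite mulrC divfK.
have a0 : 0 < acos x.
  rewrite acos_gt0//; move/andP : x1 => [-> x1]/=; rewrite lt_neqAle x1 andbT.
  by apply/eqP => xE; move: xy1; rewrite xE; have := y0; nra.
exists (pi *+ 2 - acos x).
  rewrite subr_ge0 gtrBl a0 andbT (le_trans (acos_lepi x1))// mulr2n lerDl ltW//.
have sc : sin (pi *+ 2 - acos x) = y /\ cos (pi *+ 2 - acos x) = x.
  rewrite addrC sinD2pi cosD2pi sinN cosN acosK ?in_itv// sE ltr0_norm// opprK//.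
rewrite /polar sc.1 sc.2; apply: complex_ext => /=; by rewrite mulrC divfK.
Qed.

Lemma polar_derive_radius (s t : R) :
  is_curve_derive (fun t => polar t s) t (1 * polar t s).
Proof.
by rewrite mul1r; split=> /=; apply: is_derive_eq; rewrite /GRing.scale/= ?mulr0 ?add0r ?addr0 ?mulr1 1?mulrC.
Qed.

Lemma polar_derive_angle (t s : R) : is_curve_derive (polar t) s ('i%C * polar t s).
Proof.
split=> /=; apply: is_derive_eq; rewrite /GRing.scale/=; ring.
Qed.

Lemma polar_continuous (p : R * R) : {for p, continuous (fun p => polar p.1 p.2)}.
Proof.
have c1 : {for p, continuous (fun p : R * R => expR p.1)}.
  by apply: continuous_comp; [exact: cvg_fst|exact: continuous_expR].
apply: cvg_ReIm => /=; apply: cvgM; first exact: c1.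
- by apply: continuous_comp; [exact: cvg_snd|exact: continuous_cos].
- exact: c1.
- by apply: continuous_comp; [exact: cvg_snd|exact: continuous_sin].
Qed.

End Polar_coordinates.

(** * Integrals over level curves *)

Section Modulus_derivative.
Context {R : realType}.

Lemma is_derive_cabs (c : R -> C R) (s : R) (d : C R) : c s != 0 ->
  is_curve_derive c s d ->
  is_derive s 1 (fun s => cabs (c s)) (complex.Re ((c s)^* * d) / cabs (c s)).
Proof.
move=> c0 [dr di].
have cE r : cabs (c r) = Num.sqrt (complex.Re (c r) ^+ 2 + complex.Im (c r) ^+ 2).
  by case: (c r).
pose q (r : R) := complex.Re (c r) ^+ 2 + complex.Im (c r) ^+ 2.
rewrite (_ : (fun s => cabs (c s)) = Num.sqrt \o q); last first.
  by apply/funext => r; rewrite cE.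
have q0 : 0 < q s.
  by rewrite /q -cabs_sqr exprn_gt0// cabs_gt0.
have dsq := is_derive1_sqrt q0.
have dq : is_derive s 1 q (2 * complex.Re ((c s)^* * d)).
  rewrite /q; under eq_fun do rewrite !expr2.
  by apply: is_derive_eq; rewrite /GRing.scale/= !ReImE; ring.
have dc := @is_derive1_comp _ Num.sqrt q s _ _ dsq dq; apply: (is_derive_eq dc).
rewrite /q -cE; have cp : cabs (c s) != 0 by rewrite cabs_eq0.
by field.
Qed.

End Modulus_derivative.

Section Level_integral.
Context {R : realType}.
Variables (U : set (C R)) (f : C R -> C R) (I : set R).
Hypothesis oU : open U.
Hypothesis hf : holomorphic_on U f.
Hypothesis f'0 : forall z, U z -> derive1 f z != 0.
Hypothesis oI : open I.
Hypothesis proper : forall K : set R, compact K -> K `<=` I ->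
  compact [set z | U z /\ exists2 t, K t & cabs (f z) = expR t].

Local Notation plane := (caratheodory_type (@hausdorff1_outer R)).

Definition level (t : R) : set (C R) := [set z | U z /\ cabs (f z) = expR t].

Lemma level_compact t : I t -> compact (level t).
Proof.
move=> It; have -> : level t = [set z | U z /\ exists2 t', [set t] t' & cabs (f z) = expR t'].
  apply/seteqP; split=> z [Uz]; first by move=> fz; split=> //; exists t.
  by move=> [t' -> ?]; split.
by apply: proper => [|_ ->//]; exact: compact_set1.
Qed.

(** Properness confines the fibers close to a given one to the compact part of [U]
    where [ln (cabs (f z))] lies in a compact interval. *)
Lemma level_sheets t0 s0 : I t0 ->
  exists n (phi : 'I_n -> C R -> C R), \forall w \near polar t0 s0, sheets_at U f phi w.
Proof.
move=> It0; have /nbhs_ballP[d0 /= d00 d0P] : nbhs t0 I by exact: open_nbhs_nbhs.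
pose d := d0 / 2; have dp : 0 < d by rewrite divr_gt0.
pose K := `[t0 - d, t0 + d]%classic.
have KI : K `<=` I.
  move=> t; rewrite /K/= in_itv/= => /andP[h1 h2]; apply: d0P; rewrite /ball/=.
  by rewrite ltr_norml; move: h1 h2; rewrite /d => h1 h2; apply/andP; split; lra.
apply: (@local_sheets _ U f oU hf f'0 _ _ (proper (@segment_compact _ _ _) KI)).
  by move=> z [].
have nw : \forall w \near polar t0 s0, expR (t0 - d) < cabs w < expR (t0 + d).
  have nr : nbhs (cabs (polar t0 s0)) `]expR (t0 - d), expR (t0 + d)[%classic.
    apply: open_nbhs_nbhs; split; first exact: interval_open.
    by rewrite cabs_polar /= in_itv/= !ltr_expR gtrBl dp ltrDl.
  have nn : \forall w \near polar t0 s0, `]expR (t0 - d), expR (t0 + d)[%classic (cabs w).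
    exact: cabs_continuous nr.
  by apply: filterS nn => w; rewrite /= in_itv.
apply: filterS nw => w /andP[w1 w2] z [Uz fz]; split=> //.
have w0 : 0 < cabs w by rewrite (lt_trans _ w1)// expR_gt0.
exists (ln (cabs w)); last by rewrite lnK ?fz// posrE.
by rewrite /K/= in_itv/= -(ler_expR (t0 - d)) -(ler_expR (ln _)) lnK ?posrE// !ltW.
Qed.

Lemma sum_cvg (T : Type) (F : set_system T) (FF : Filter F) n (g : 'I_n -> T -> R)
    (a : 'I_n -> R) : (forall i, g i x @[x --> F] --> a i) ->
  \sum_(i < n) g i x @[x --> F] --> \sum_(i < n) a i.
Proof.
elim: n g a => [|n IH] g a ga.
  by under eq_fun do rewrite big_ord0; rewrite big_ord0; exact: cvg_cst.
under eq_fun do rewrite big_ord_recr; rewrite big_ord_recr /=.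
by apply: cvgD; [apply: IH|].
Qed.

(** Near the given point the sum runs over a fixed finite set of sheets. *)
Lemma fiber_sum_continuous (H : C R -> R) (t0 s0 : R) : I t0 ->
  (forall z, U z -> {for z, continuous H}) ->
  {for polar t0 s0, continuous (fiber_sum U f H)}.
Proof.
move=> It0 cH; have [n [phi phiP]] := level_sheets s0 It0.
set w0 := polar t0 s0 in phiP *.
have s0P := nbhs_singleton phiP.
have : \sum_(i < n) H (phi i w) @[w --> w0] --> fiber_sum U f H w0.
  rewrite (fiber_sumE H s0P); apply: (@sum_cvg _ (nbhs w0)) => i.
  apply: continuous_comp; last by apply: cH; have [] := sheet_fiber s0P i.
  exact: complex_derive_continuous (sheet_derive s0P i).
apply: cvg_trans; apply: (@near_eq_cvg _ _ (nbhs w0)).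
by apply: filterS phiP => w wP; rewrite (fiber_sumE H wP).
Qed.

(** Along [s |-> polar t s] each sheet runs through the level curve with speed
    [cabs (f z / derive1 f z)]. *)
Definition density (H : C R -> R) (z : C R) : R := H z * cabs (f z / derive1 f z).

Definition sector (t x y : R) : set (C R) :=
  [set z | U z /\ exists2 s, x <= s < y & f z = polar t s].

(** The derivative [(derive1 f)^-1] of a sheet is multiplied by that of [c], and the
    value of [c] is that of [f] on the sheet.  The cases of interest are [lam = 1]
    when the modulus of [c] varies and [lam = 'i] when its argument does. *)
Lemma sheet_curve_derive n (phi : 'I_n -> C R -> C R) (c : R -> C R) (s : R) (lam : C R) i :
  sheets_at U f phi (c s) -> is_curve_derive c s (lam * c s) ->
  is_curve_derive (fun s => phi i (c s)) s
    (lam * (f (phi i (c s)) / derive1 f (phi i (c s)))).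
Proof.
move=> sP cD; have [_ fE] := sheet_fiber sP i.
have := is_curve_derive_comp cD (sheet_derive sP i).
by rewrite fE mulrCA [X in is_curve_derive _ _ (_ * X)]mulrC.
Qed.

Lemma flow_continuous z : U z -> {for z, continuous (fun z => f z / derive1 f z)}.
Proof.
move=> Uz; apply: (@cvgM _ _ (nbhs z) _ f (fun z => (derive1 f z)^-1)
  (f z) (derive1 f z)^-1); first exact: (holomorphic_continuous hf Uz).
apply: (@cvgV _ _ (nbhs z) _ (derive1 f) (derive1 f z)); first exact: f'0.
exact: (holomorphic_continuous (holomorphic_derive hf) Uz).
Qed.

Lemma density_continuous (H : C R -> R) : (forall z, U z -> {for z, continuous H}) ->
  forall z, U z -> {for z, continuous (density H)}.
Proof.
move=> cH z Uz; apply: (@cvgM _ _ (nbhs z) _ H (fun z => cabs (f z / derive1 f z))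
  (H z) (cabs (f z / derive1 f z))); first exact: cH.
apply: (@continuous_comp _ _ _ (fun z => f z / derive1 f z)); last exact: cabs_continuous.
exact: flow_continuous.
Qed.

(** The part of the level curve over a short interval of angles is the disjoint
    union of one short arc for each sheet. *)
Lemma integral_short_sector (H : C R -> R) (t s0 e : R) : I t ->
  (forall z, U z -> {for z, continuous H}) -> 0 < e ->
  \forall x \near s0 & y \near s0, x <= y ->
    (hausdorff1 (sector t x y) < +oo)%E /\
    `|\int[arc_length R]_(z in sector t x y) H z -
      fiber_sum U f (density H) (polar t s0) * (y - x)| <= e * (y - x).
Proof.
move=> It cH e0; have [n [phi phiP]] := level_sheets s0 It.
pose c i (s : R) : C R := phi i (polar t s).
have pc (s : R) : {for s, continuous (polar t)}.
  exact: curve_derive_continuous (polar_derive_angle t s).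
have phis : \forall s \near s0, sheets_at U f phi (polar t s) by exact: pc.
have s0P := nbhs_singleton phis.
pose dc i s : C R := 'i%C * (f (c i s) / derive1 f (c i s)).
have cD : forall i, \forall s \near s0, is_curve_derive (c i) s (dc i s) /\ U (c i s).
  move=> i; apply: filterS phis => s sP; split; last by have [] := sheet_fiber sP i.
  exact: (sheet_curve_derive i sP (polar_derive_angle t s)).
have cc i : {for s0, continuous (c i)}.
  exact: curve_derive_continuous (nbhs_singleton (cD i)).1.
have dcc i : {for s0, continuous (dc i)}.
  apply: cvgM; first exact: cvg_cst.
  apply: (@continuous_comp _ _ _ (c i) (fun z => f z / derive1 f z)); first exact: cc.
  exact: flow_continuous (nbhs_singleton (cD i)).2.
have en0 : 0 < e / n.+1%:R by rewrite divr_gt0.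
have arcs : \forall x \near s0 & y \near s0, forall i : 'I_n, x <= y ->
    forall A, A = c i @` `[x, y[ ->
    [/\ measurable (A : set plane), A `<=` U, (hausdorff1 A < +oo)%E,
        (arc_length R).-integrable A (EFin \o H) &
        `|\int[arc_length R]_(z in A) H z - H (c i s0) * cabs (dc i s0) * (y - x)|
          <= e / n.+1%:R * (y - x)].
  apply: (@filter_forall _ _ _ (filter_prod (nbhs s0) (nbhs s0))) => i.
  exact: (integral_short_arc oU cH (cD i) (dcc i) en0).
(* On intervals of length less than [2 * pi] the angle is a function of the point,
   so arcs on different sheets do not meet. *)
have nearpi : \forall x \near s0 & y \near s0, `|x - y| < pi *+ 2 /\
    forall s, x <= s <= y -> sheets_at U f phi (polar t s).
  have [d d0 dP] : exists2 d : R, 0 < d & forall s, `|s - s0| < d -> sheets_at U f phi (polar t s).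
    move/nbhs_ballP : phis => [d /= d0 dP]; exists d => // s sd.
    by apply: dP; rewrite /ball/= distrC.
  have p0 := @pi_gt0 R.
  pose d' := Num.min d pi; have d'0 : 0 < d' by rewrite lt_min d0.
  exists ([set x | `|s0 - x| < d'], [set x | `|s0 - x| < d']).
    by split; apply/nbhs_ballP; exists d'.
  move=> [x y] /=; rewrite !lt_min !ltr_norml => -[/andP[/andP[? ?] /andP[? ?]] /andP[/andP[? ?] /andP[? ?]]].
  split; first by rewrite mulr2n; apply/andP; split; lra.
  move=> s /andP[xs sy]; apply: dP; rewrite ltr_norml; apply/andP; split; lra.
apply: filterS2 arcs nearpi => -[x y] /= arcs [xypi sP] xy.
pose A i := c i @` `[x, y[.
have mA i : measurable (A i : set plane) by have [] := arcs i xy _ erefl.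
have sE : sector t x y = \big[setU/set0]_(i <- index_enum 'I_n) A i.
  rewrite -bigcup_seq; apply/seteqP; split=> z.
    move=> [Uz [s /andP[xs sy] fz]].
    have sPs : sheets_at U f phi (polar t s) by apply: sP; rewrite xs ltW.
    have [i zi] := sheet_all sPs (conj Uz fz).
    by exists i; [rewrite /= mem_index_enum|exists s => //=; rewrite in_itv/= xs].
  move=> [i _ [s /= + <-]]; rewrite in_itv/= => /andP[xs sy].
  have sPs : sheets_at U f phi (polar t s) by apply: sP; rewrite xs ltW.
  by have [Uz fz] := sheet_fiber sPs i; split=> //; exists s; rewrite ?xs.
have tA : trivIset [set` index_enum 'I_n] A.
  move=> i j _ _ [z [[s /= + <-] [s' /= +]]].
  rewrite !in_itv/= => /andP[xs sy] /andP[xs' s'y] cij.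
  have sPs : sheets_at U f phi (polar t s) by apply: sP; rewrite xs ltW.
  have sPs' : sheets_at U f phi (polar t s') by apply: sP; rewrite xs' ltW.
  have [_ fi] := sheet_fiber sPs i; have [_ fj] := sheet_fiber sPs' j.
  have ss' : s = s'.
    apply: (@polar_inj _ t); last by rewrite -fi -fj -[phi j _]/(c j s') cij.
    apply: le_lt_trans xypi; rewrite distrC [leRHS]distrC [leRHS]ger0_norm ?subr_ge0//.
    by rewrite ler_norml; apply/andP; split; lra.
  by apply: (sheet_inj sPs); rewrite -/(c i s) -cij ss'.
have AU : sector t x y `<=` U by move=> z [].
have msec : measurable (sector t x y : set plane).
  by rewrite sE; apply: (@bigsetU_measurable _ plane).
split.
  rewrite sE; apply: (big_ind (fun B => (hausdorff1 B < +oo)%E)).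
  - by rewrite hausdorff1_set0 ltry.
  - move=> B B' Boo B'oo.
    apply: (le_lt_trans (outer_measureU2 (@hausdorff1_outer R) B B')).
    by rewrite lte_add_pinfty.
  - by move=> i _; have [] := arcs i xy _ erefl.
have -> : \int[arc_length R]_(z in sector t x y) H z =
    \sum_(i < n) \int[arc_length R]_(z in A i) H z.
  rewrite /Rintegral sE integral_bigsetU_EFin//; last 2 first.
  - exact: index_enum_uniq.
  - apply/measurable_realfun.measurable_EFinP; rewrite -sE.
    exact: (continuous_measurable_plane msec oU AU cH).
  rewrite -sum_fine// => i _; apply: integrable_fin_num.
  - exact: mA.
  - by have [] := arcs i xy _ erefl.
rewrite (fiber_sumE _ s0P) mulr_suml -sumrB (le_trans (ler_norm_sum _ _ _))//.
apply: (@le_trans _ _ (\sum_(i < n) e / n.+1%:R * (y - x))).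
  apply: ler_sum => i _; have [_ _ _ _] := arcs i xy _ erefl.
  rewrite /dc cabsM (_ : cabs 'i%C = 1) ?mul1r//.
  by rewrite /cabs /= expr0n/= expr1n add0r sqrtr1.
rewrite sumr_const card_ord -mulrnAl ler_wpM2r ?subr_ge0// -mulr_natr -mulrA.
by rewrite ler_piMr ?(ltW e0)// mulrC ler_pdivrMr// mul1r ler_nat.
Qed.

(** A half-open interval of angles is a countable union of compact ones, and those
    define relatively closed parts of the compact level curve. *)
Lemma sector_measurable t x y : I t -> measurable (sector t x y : set plane).
Proof.
move=> It.
pose W n := U `&` f @^-1` ~` (polar t @` `[x, y - n.+1%:R^-1]).
have oW n : open (W n).
  apply: open_preimage_plane => //; first by move=> z; exact: holomorphic_continuous hf.
  apply: closed_openC; apply: compact_closed_plane; apply: arc_compact => s _.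
  exact: curve_derive_continuous (polar_derive_angle t s).
have -> : sector t x y = \bigcup_n (level t `\` W n).
  apply/seteqP; split=> z.
    move=> [Uz [s /andP[xs sy] fz]]; have [n sn] := ltr_add_invr sy.
    exists n => //; split; first by split=> //; rewrite fz cabs_polar.
    move=> [_ /=]; apply; exists s => //=.
    by rewrite in_itv/= xs lerBrDr ltW.
  move=> [n _ [[Uz _] nW]]; split=> //.
  have [s /= + fz] : (polar t @` `[x, y - n.+1%:R^-1]) (f z).
    by apply: contrapT => nf; apply: nW.
  rewrite in_itv/= => /andP[xs sy]; exists s => //.
  by rewrite xs (le_lt_trans sy)// ltrBlDr ltrDl.
apply: (@bigcup_measurable _ plane) => n _; apply: (@measurableD _ plane).
  by apply: closed_measurable_plane; apply: compact_closed_plane; apply: level_compact.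
exact: open_measurable_plane.
Qed.

Lemma level_sector t : level t = sector t 0 (pi *+ 2).
Proof.
apply/seteqP; split=> z [Uz].
  by move=> /polar_surj[s s2 fz]; split=> //; exists s.
by move=> [s _ fz]; split=> //; rewrite fz cabs_polar.
Qed.

(** Short sectors have finite length, and finitely many of them cover the turn. *)
Lemma level_length_finite t : I t -> (hausdorff1 (level t) < +oo)%E.
Proof.
move=> It.
pose S (V : set R) := [set z | U z /\ exists2 s, V s & f z = polar t s].
pose turn : set R := `[0, pi *+ 2]%classic.
have : (hausdorff1 (S turn) < +oo)%E.
  apply: (@compact_ideal _ turn (fun V => (hausdorff1 (S V) < +oo)%E)).
  - rewrite (_ : S set0 = set0) ?hausdorff1_set0 ?ltry//.
    by apply/seteqP; split=> z // [_ [s]].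
  - move=> A B AB; apply: le_lt_trans; apply: le_hausdorff1 => z [Uz [s As fz]].
    by split=> //; exists s => //; exact: AB.
  - move=> A B Aoo Boo; apply: (@le_lt_trans _ _ (hausdorff1 (S A) + hausdorff1 (S B))%E).
      apply: le_trans (outer_measureU2 (@hausdorff1_outer R) _ _).
      apply: le_hausdorff1 => z [Uz [s [As|Bs] fz]]; [left|right].
        by split=> //; exists s.
      by split=> //; exists s.
    by rewrite lte_add_pinfty.
  - exact: segment_compact.
  move=> s0 _; have [[A B] /= [nA nB] AB] := integral_short_sector s0 It
    (fun z _ => @cst_continuous _ _ (0 : R) z) (@ltr01 R).
  move/nbhs_ballP: nA => [d1 /= d10 d1P]; move/nbhs_ballP: nB => [d2 /= d20 d2P].
  pose d := Num.min d1 d2 / 2.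
  have d0 : 0 < d by rewrite divr_gt0// lt_min d10.
  have dd : d < d1 /\ d < d2.
    have m0 : 0 < Num.min d1 d2 by rewrite lt_min d10.
    by split; rewrite (@lt_le_trans _ _ (Num.min d1 d2)) ?ge_min ?lexx ?orbT// /d; lra.
  exists `[s0 - d, s0 + d[%classic.
    apply/nbhs_ballP; exists d => // s; rewrite /ball/= ltr_norml in_itv/= => /andP[? ?].
    by apply/andP; split; lra.
  have [||] := AB (s0 - d, s0 + d).
  - split; [apply: d1P|apply: d2P]; rewrite /ball/=.
      by rewrite opprB addrC subrK gtr0_norm//; case: dd.
    by rewrite opprD addrA subrr add0r normrN gtr0_norm//; case: dd.
  - by rewrite /= lerBlDr -addrA lerDl addr_ge0// ltW.
  move=> /= soo _; apply: le_lt_trans soo; apply: le_hausdorff1 => z [Uz [s /= + fz]].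
  by rewrite in_itv/= => sd; split=> //; exists s.
apply: le_lt_trans; apply: le_hausdorff1; rewrite level_sector => z [Uz [s s2 fz]].
by split=> //; exists s; rewrite // /turn/= in_itv/=; case/andP: s2 => -> /ltW ->.
Qed.

Lemma level_integrable (H : C R -> R) t : I t ->
  (forall z, U z -> {for z, continuous H}) ->
  (arc_length R).-integrable (level t) (EFin \o H).
Proof.
move=> It cH; have cE := level_compact It.
have mE : measurable (level t : set plane).
  by apply: closed_measurable_plane; apply: compact_closed_plane.
have EU : level t `<=` U by move=> z [].
apply: measurable_bounded_integrable => //.
- exact: level_length_finite.
- exact: (continuous_measurable_plane mE oU EU cH).
have cHE : compact (H @` level t).
  apply: continuous_compact cE; apply: continuous_in_subspaceT => z.
  by rewrite inE => /EU; exact: cH.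
have [M [_ HM]] := compact_bounded cHE.
exists M; split; first exact: num_real.
by move=> N MN z Ez /=; apply: (HM N MN); exists z.
Qed.

(** The integral over the sector of angles less than [y] is an antiderivative, as
    a function of [y], of the fiberwise sum of the density. *)
Lemma level_integral (H : C R -> R) t : I t ->
  (forall z, U z -> {for z, continuous H}) ->
  \int[arc_length R]_(z in level t) H z =
  \int[lebesgue_measure]_(s in `[0, pi *+ 2]) fiber_sum U f (density H) (polar t s).
Proof.
move=> It cH; set p2 : R := pi *+ 2.
have p20 : 0 < p2 by rewrite pmulrn_lgt0// pi_gt0.
pose Phi s := fiber_sum U f (density H) (polar t s).
pose F y := \int[arc_length R]_(z in sector t 0 y) H z.
have iE := level_integrable It cH.
have mE : measurable (level t : set plane).
  by apply: closed_measurable_plane; apply: compact_closed_plane; apply: level_compact.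
have sub x y : sector t x y `<=` level t.
  by move=> z [Uz [s _ fz]]; split=> //; rewrite fz cabs_polar.
have F0 : F 0 = 0.
  rewrite /F (_ : sector t 0 0 = set0) ?Rintegral_set0//.
  apply/seteqP; split=> z // [_ [s /andP[s0 s1]]].
  by move: (le_lt_trans s0 s1); rewrite ltxx.
have add x y : 0 <= x -> x <= y -> y <= p2 ->
    F y = F x + \int[arc_length R]_(z in sector t x y) H z.
  move=> x0 xy y2.
  have sE : sector t 0 y = sector t 0 x `|` sector t x y.
    apply/seteqP; split=> z.
      move=> [Uz [s /andP[s0 sy] fz]]; have [sx|xs] := ltP s x; [left|right].
        by split=> //; exists s => //; rewrite s0.
      by split=> //; exists s => //; rewrite xs.
    move=> [[Uz [s /andP[s0 sx] fz]]|[Uz [s /andP[s0 sx] fz]]].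
      by split=> //; exists s => //; rewrite s0 (lt_le_trans sx).
    by split=> //; exists s => //; rewrite (le_trans x0 s0).
  rewrite /F sE Rintegral_setU//.
  - exact: sector_measurable.
  - exact: sector_measurable.
  - apply: (integrableS mE) iE; last by rewrite -sE; exact: sub.
    by rewrite -sE; exact: sector_measurable.
  - apply/disj_set2P; apply/seteqP; split=> z //.
    move=> [[Uz [s /andP[s0 sx] fz]] [_ [s' /andP[xs' s'y] fz']]].
    have ss' : s = s'.
      apply: (@polar_inj _ t); last by rewrite -fz -fz'.
      by rewrite ltr_norml; rewrite /p2 in y2; apply/andP; split; lra.
    by move: sx; rewrite ss' ltNge xs'.
(* This estimate also holds at the end points of the turn, where it yields the
   one-sided continuity that the fundamental theorem of calculus asks for. *)
have key s0 e : 0 <= s0 <= p2 -> 0 < e -> exists2 d : R, 0 < d &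
    forall y, 0 <= y <= p2 -> `|y - s0| < d -> `|F y - F s0 - Phi s0 * (y - s0)| <= e * `|y - s0|.
  move=> /andP[s00 s02] e0.
  have [[A B] /= [nA nB] AB] := integral_short_sector s0 It cH e0.
  move/nbhs_ballP: nA => [d1 /= d10 d1P]; move/nbhs_ballP: nB => [d2 /= d20 d2P].
  exists (Num.min d1 d2); first by rewrite lt_min d10.
  move=> y /andP[y0 y2]; rewrite lt_min => /andP[yd1 yd2].
  have [ys|sy] := leP y s0.
    have [||_] := AB (y, s0) => //=.
      by split; [apply: d1P|apply: d2P]; rewrite /ball/= ?subrr ?normr0// distrC.
    rewrite (add y s0)// [`|y - s0|]distrC (ger0_norm (x := s0 - y)) ?subr_ge0//.
    by rewrite -normrN; congr (`| _ | <= _); rewrite -/(Phi s0); ring.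
  have [||_] := AB (s0, y) => /=.
  - by split; [apply: d1P|apply: d2P]; rewrite /ball/= ?subrr ?normr0// distrC.
  - exact: ltW.
  rewrite (add s0 y) ?(ltW sy)// (ger0_norm (x := y - s0)) ?subr_ge0 ?(ltW sy)//.
  by congr (`| _ | <= _); rewrite -/(Phi s0); ring.
have Fcvg s0 (G : set_system R) (FG : Filter G) : 0 <= s0 <= p2 ->
    (\forall y \near G, 0 <= y <= p2) -> y @[y --> G] --> s0 -> F y @[y --> G] --> F s0.
  move=> s02 G2 Gs; have [d d0 dP] := key s0 1 s02 ltr01.
  apply/cvgRP => e e0.
  pose M := `|Phi s0| + 1; have M0 : 0 < M by rewrite ltr_wpDl.
  have h1 : \forall y \near G, `|y - s0| < d by move/cvgRP: Gs; apply.
  have h2 : \forall y \near G, `|y - s0| < e / M.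
    by move/cvgRP: Gs; apply; rewrite divr_gt0.
  apply: filterS3 G2 h1 h2 => y y2 yd; rewrite ltr_pdivlMr// => ye.
  apply: le_lt_trans ye.
  have := ler_normD (F y - F s0 - Phi s0 * (y - s0)) (Phi s0 * (y - s0)).
  rewrite subrK => /le_trans; apply; rewrite normrM /M [leRHS]mulrC mulrDl addrC lerD2l.
  exact: dP.
have Fder s0 : 0 < s0 < p2 -> is_derive s0 1 F (Phi s0).
  move=> /andP[s00 s02]; apply/is_derive_realP => e e0.
  have [|d d0 dP] := key s0 e _ e0; first by rewrite !ltW.
  exists (Num.min d (Num.min s0 (p2 - s0))); first by rewrite !lt_min d0 s00 subr_gt0.
  move=> h; rewrite !lt_min !ltr_norml => /andP[/andP[h1 h2] /andP[/andP[h3 h4] /andP[h5 h6]]].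
  have := dP (s0 + h); rewrite addrAC subrr add0r; apply.
    by apply/andP; split; lra.
  by rewrite ltr_norml h1.
have FTC : (\int[lebesgue_measure]_(s in `[0%R, p2]) (Phi s)%:E = (F p2)%:E - (F 0)%:E)%E.
  apply: continuous_FTC2 => //.
  - apply: continuous_in_subspaceT => s _.
    apply: (@continuous_comp _ _ _ (polar t)).
      exact: curve_derive_continuous (polar_derive_angle t s).
    by apply: fiber_sum_continuous It (density_continuous cH).
  - split.
    + by move=> s; rewrite in_itv/= => /Fder[].
    + apply: Fcvg; first by rewrite lexx ltW.
      * by near=> y; apply/andP; split; [near: y; exact: nbhs_right_ge|near: y; exact: nbhs_right_le].
      * exact: cvg_at_right_filter.
    + apply: Fcvg; first by rewrite lexx ltW.
      * by near=> y; apply/andP; split; [near: y; exact: nbhs_left_ge|near: y; exact: nbhs_left_le].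
      * exact: cvg_at_left_filter.
  - by move=> s; rewrite in_itv/= => /Fder[_ <-]; rewrite derive1E.
by rewrite {2}/Rintegral FTC F0 sube0 level_sector.
Unshelve. all: by end_near. Qed.

(** * Derivatives of integrals over level curves *)

Hypothesis f0 : forall z, U z -> f z != 0.

(** The factor [mu] gives access to the imaginary part of [(v z)^* * u z], which is
    the one whose angular derivative is needed. *)
Definition pairing (mu : C R) (u v : C R -> C R) (z : C R) : R :=
  complex.Re (mu * ((v z)^* * u z)).

(** Up to the factor [cabs (f z / derive1 f z)], the derivative of the density of
    [pairing mu u v] in the direction [lam] of the coordinate [log f]. *)
Definition flow_pairing (lam mu : C R) (u v : C R -> C R) (z : C R) : R :=
  1 / 2 * (pairing (mu * lam) (G_op f u) v z + pairing (mu * lam^*) u (G_op f v) z).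

Lemma pairing_continuous mu u v : holomorphic_on U u -> holomorphic_on U v ->
  forall z, U z -> {for z, continuous (pairing mu u v)}.
Proof.
move=> hu hv z Uz.
have cu := holomorphic_continuous hu Uz; have cv := holomorphic_continuous hv Uz.
have cur : {for z, continuous (fun z => complex.Re (u z))}.
  by apply: continuous_comp; [exact: cu|exact: Re_continuous].
have cui : {for z, continuous (fun z => complex.Im (u z))}.
  by apply: continuous_comp; [exact: cu|exact: Im_continuous].
have cvr : {for z, continuous (fun z => complex.Re (v z))}.
  by apply: continuous_comp; [exact: cv|exact: Re_continuous].
have cvi : {for z, continuous (fun z => complex.Im (v z))}.
  by apply: continuous_comp; [exact: cv|exact: Im_continuous].
rewrite (_ : pairing mu u v = fun z =>
   complex.Re mu * (complex.Re (v z) * complex.Re (u z) + complex.Im (v z) * complex.Im (u z)) -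
   complex.Im mu * (complex.Re (v z) * complex.Im (u z) - complex.Im (v z) * complex.Re (u z))).
  have cM (g h : C R -> R) : {for z, continuous g} -> {for z, continuous h} ->
      {for z, continuous (fun z => g z * h z)}.
    by move=> cg ch; exact: (@cvgM _ _ (nbhs z) _ g h _ _ cg ch).
  apply: (@cvgB _ _ _ (nbhs z)); apply: (cM); try exact: cst_continuous.
    by apply: (@cvgD _ _ _ (nbhs z)); exact: (cM).
  by apply: (@cvgB _ _ _ (nbhs z)); exact: (cM).
by apply/funext => y; rewrite /pairing !ReImE; ring.
Qed.

(** Let [h_w] be a local branch of [w] times the square root of [g = f / derive1 f].
    The density of [pairing mu u v] is the real part of [mu * (h_v^* * h_u)], and
    [h_(G_op f w)] is twice the derivative of [h_w] with respect to [log f], so this is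
    the Leibniz rule.  Below, the roots are avoided by differentiating the modulus
    of [g] instead. *)
Lemma density_pairing_derive mu lam u v (c : R -> C R) (s : R) :
  holomorphic_on U u -> holomorphic_on U v -> U (c s) ->
  is_curve_derive c s (lam * (f (c s) / derive1 f (c s))) ->
  is_derive s 1 (fun s => density (pairing mu u v) (c s))
    (density (flow_pairing lam mu u v) (c s)).
Proof.
move=> hu hv Uc cD; pose g z := f z / derive1 f z.
have hg : holomorphic_on U g.
  by apply: holomorphicM => //; apply: holomorphicV => //; exact: holomorphic_derive.
have gn0 : g (c s) != 0 by rewrite mulf_neq0 ?invr_neq0 ?f0 ?f'0.
have Du := is_curve_derive_comp cD (holomorphic_is_derive hu Uc).
have Dv := is_curve_derive_comp cD (holomorphic_is_derive hv Uc).
have Dg := is_curve_derive_comp cD (holomorphic_is_derive hg Uc).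
have Da := @is_derive_cabs _ (g \o c) s _ gn0 Dg.
have [Du1 Du2] := Du; have [Dv1 Dv2] := Dv.
rewrite (_ : (fun s => density (pairing mu u v) (c s)) = fun s =>
   (complex.Re mu * (complex.Re ((v \o c) s) * complex.Re ((u \o c) s) +
                     complex.Im ((v \o c) s) * complex.Im ((u \o c) s)) -
    complex.Im mu * (complex.Re ((v \o c) s) * complex.Im ((u \o c) s) -
                     complex.Im ((v \o c) s) * complex.Re ((u \o c) s))) *
   cabs ((g \o c) s)); last first.
  by apply/funext => r; rewrite /density /pairing /g !ReImE /=; congr (_ * _); ring.
apply: is_derive_eq; rewrite /GRing.scale/=.
rewrite -[f (c s) / derive1 f (c s)]/(g (c s)).
have ap : cabs (g (c s)) != 0 by rewrite cabs_eq0.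
(* The logarithmic derivative of the modulus of [g] along the curve is the real
   part of [derive1 g * lam]. *)
have gg : complex.Re ((g (c s))^* * (derive1 g (c s) * (lam * g (c s)))) / cabs (g (c s)) =
    cabs (g (c s)) * complex.Re (derive1 g (c s) * lam).
  apply: (mulIf ap); rewrite divfK// mulrAC -expr2 cabs_sqr !ReImE; ring.
rewrite gg /density /flow_pairing /pairing /G_op -/g -[f (c s) / derive1 f (c s)]/(g (c s)).
move: (cabs (g (c s))) => a.
have r2 : complex.Re (2 : C R) = 2 by rewrite /= -[2]/(1 + 1) /= .
have i2 : complex.Im (2 : C R) = 0 by rewrite /= addr0.
move: (derive1 g (c s)) (derive1 u (c s)) (derive1 v (c s)) (g (c s)) (u (c s)) (v (c s)).
move: (2 : C R) r2 i2; clear => k r2 i2 g1 u1 v1 g0 u0 v0.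
by rewrite !ReImE r2 i2; field.
Qed.

Lemma holomorphic_flow w : holomorphic_on U w -> holomorphic_on U (G_op f w).
Proof. exact: holomorphic_G. Qed.

Lemma flow_pairing_continuous lam mu u v : holomorphic_on U u -> holomorphic_on U v ->
  forall z, U z -> {for z, continuous (flow_pairing lam mu u v)}.
Proof.
move=> hu hv z Uz.
have c1 := pairing_continuous (mu := mu * lam) (holomorphic_flow hu) hv Uz.
have c2 := pairing_continuous (mu := mu * lam^*) hu (holomorphic_flow hv) Uz.
apply: (@cvgM _ _ (nbhs z) _ (fun=> 1 / 2)); first exact: cvg_cst.
exact: (@cvgD _ _ _ (nbhs z) _ _ _ _ _ c1 c2).
Qed.

Lemma fiber_sum_derive mu lam u v (c : R -> C R) (t0 s0 x : R) :
  holomorphic_on U u -> holomorphic_on U v -> I t0 -> c x = polar t0 s0 ->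
  is_curve_derive c x (lam * c x) ->
  is_derive x 1 (fun x => fiber_sum U f (density (pairing mu u v)) (c x))
    (fiber_sum U f (density (flow_pairing lam mu u v)) (c x)).
Proof.
move=> hu hv It0 cx cD; have [n [phi phiP]] := level_sheets s0 It0.
rewrite -cx in phiP; have xP := nbhs_singleton phiP.
have cc := curve_derive_continuous cD.
have phix : \forall y \near x, sheets_at U f phi (c y) by exact: cc.
rewrite (fiber_sumE _ xP).
apply: (@near_eq_is_derive _ _ _ (\sum_(i < n) (fun y => density (pairing mu u v) (phi i (c y))))).
  by apply: filterS phix => y yP; rewrite (fiber_sumE _ yP) fct_sumE.
apply: is_derive_sum => i.
apply: density_pairing_derive => //; first by have [] := sheet_fiber xP i.
exact: (sheet_curve_derive i xP cD).
Qed.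

Lemma fiber_sum_joint_continuous (H : C R -> R) (t0 s0 : R) : I t0 ->
  (forall z, U z -> {for z, continuous H}) ->
  {for (t0, s0), continuous (fun p : R * R => fiber_sum U f (density H) (polar p.1 p.2))}.
Proof.
move=> It0 cH; apply: (@continuous_comp _ _ _ (fun p : R * R => polar p.1 p.2)).
  exact: polar_continuous.
by apply: fiber_sum_continuous It0 (density_continuous cH).
Qed.

Local Notation turn := (`[0, pi *+ 2]%classic : set R).

(** Joint continuity in [(t, s)] and compactness of the turn; this bound dominates the
    derivative in [t] under the integral sign. *)
Lemma fiber_sum_bounded (H : C R -> R) (t0 : R) : I t0 ->
  (forall z, U z -> {for z, continuous H}) ->
  exists M : R, \forall t \near t0, forall s, turn s ->
    `|fiber_sum U f (density H) (polar t s)| <= M.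
Proof.
move=> It0 cH.
apply: (@compact_ideal _ turn (fun V => exists M : R, \forall t \near t0, forall s, V s ->
    `|fiber_sum U f (density H) (polar t s)| <= M)).
- by exists 0; apply: filterE => t s [].
- by move=> A B AB [M BM]; exists M; apply: filterS BM => t BM s /AB; exact: BM.
- move=> A B [M AM] [N BN]; exists (Num.max M N).
  apply: filterS2 AM BN => t AM BN s [As|Bs]; rewrite le_max.
    by rewrite AM.
  by rewrite BN ?orbT.
- exact: segment_compact.
move=> s _; have /cvgRP/(_ 1 ltr01)[[A B] /= [nA nB] AB] := fiber_sum_joint_continuous (s0 := s) It0 cH.
exists B; first exact: nB.
exists (`|fiber_sum U f (density H) (polar t0 s)| + 1).
apply: filterS nA => t At s' Bs'.
have /= h := AB (t, s') (conj At Bs').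
have := ler_normD (fiber_sum U f (density H) (polar t s') - fiber_sum U f (density H) (polar t0 s))
  (fiber_sum U f (density H) (polar t0 s)).
by rewrite subrK; move/ltW : h; lra.
Qed.

Lemma fiber_sum_within (H : C R -> R) (t : R) : I t ->
  (forall z, U z -> {for z, continuous H}) ->
  {within turn, continuous (fun s => fiber_sum U f (density H) (polar t s))}.
Proof.
move=> It cH; apply: continuous_in_subspaceT => s _.
apply: (@continuous_comp _ _ _ (polar t)).
  exact: curve_derive_continuous (polar_derive_angle t s).
by apply: fiber_sum_continuous It (density_continuous cH).
Qed.

Definition level_pairing (mu : C R) u v (t : R) : R :=
  \int[arc_length R]_(z in level t) pairing mu u v z.

(** The integral over the level curve is an integral over a fixed interval of angles,
    under which the derivative in [t] is taken. *)
Lemma level_pairing_derive_flow mu u v t0 : holomorphic_on U u -> holomorphic_on U v -> I t0 ->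
  is_derive t0 1 (level_pairing mu u v)
    (\int[arc_length R]_(z in level t0) flow_pairing 1 mu u v z).
Proof.
move=> hu hv It0.
have cp := pairing_continuous (mu := mu) hu hv.
have cfp := flow_pairing_continuous (lam := 1) (mu := mu) hu hv.
have nI : \forall t \near t0, I t by exact: open_nbhs_nbhs.
pose P t s := fiber_sum U f (density (pairing mu u v)) (polar t s).
pose Q t s := fiber_sum U f (density (flow_pairing 1 mu u v)) (polar t s).
have LP : \forall t \near t0, \int[lebesgue_measure]_(s in turn) P t s = level_pairing mu u v t.
  by apply: filterS nI => t It; rewrite /level_pairing (level_integral It cp).
apply: (near_eq_is_derive LP).
rewrite (level_integral It0 cfp) -/(Q t0 _).
have [M nM] := fiber_sum_bounded It0 cfp.
have [d d0 dP] : exists2 d : R, 0 < d & forall t, `|t - t0| < d ->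
    I t /\ forall s, turn s -> `|Q t s| <= M.
  have /nbhs_ballP[d /= d0 dP] : \forall t \near t0, I t /\ forall s, turn s -> `|Q t s| <= M.
    by apply: filterS2 nI nM => t.
  by exists d => // t td; apply: dP; rewrite /ball/= distrC.
have Id t : `]t0 - d, t0 + d[%classic t -> `|t - t0| < d.
  by rewrite /= in_itv/= ltr_norml => /andP[? ?]; apply/andP; split; lra.
have mT := @measurable_itv R `[0, pi *+ 2]%R.
have PD t s : `]t0 - d, t0 + d[%classic t -> turn s -> is_derive t 1 (P ^~ s) (Q t s).
  move=> /Id/dP[It _] _.
  exact: (@fiber_sum_derive mu 1 u v (polar^~ s) t s t hu hv It erefl (polar_derive_radius s t)).
have PE t s : `]t0 - d, t0 + d[%classic t -> turn s -> partial1of2 P t s = Q t s.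
  by move=> td sT; rewrite partial1of2E; have [] := PD t s td sT.
have t0d : `]t0 - d, t0 + d[%classic t0.
  by rewrite /= in_itv/= gtrBl ltrDl d0.
have iP t : `]t0 - d, t0 + d[%classic t -> lebesgue_measure.-integrable turn (EFin \o P t).
  move=> /Id/dP[It _]; apply: continuous_compact_integrable; first exact: segment_compact.
  exact: fiber_sum_within.
have dPt t s : `]t0 - d, t0 + d[%classic t -> turn s -> derivable (P ^~ s) t 1.
  by move=> td sT; have [] := PD t s td sT.
have iM : lebesgue_measure.-integrable turn (EFin \o (cst (Num.max M 0))).
  apply: continuous_compact_integrable; first exact: segment_compact.
  by apply: continuous_subspaceT => s; exact: cvg_cst.
have Mb t s : `]t0 - d, t0 + d[%classic t -> turn s ->
    `|partial1of2 P t s| <= cst (Num.max M 0) s.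
  move=> td sT; rewrite PE//= le_max; apply/orP; left.
  by have [_] := dP t (Id t td); apply.
have M0 (s : R) : 0 <= (cst (Num.max M 0) : R -> R) s by rewrite /= le_max lexx orbT.
have QE : \int[lebesgue_measure]_(s in turn) Q t0 s =
    \int[lebesgue_measure]_(s in turn) partial1of2 P t0 s.
  by apply: eq_Rintegral => s; rewrite inE => sT; rewrite PE.
rewrite QE; split.
  exact: (derivable_under_integral (mu := lebesgue_measure) mT t0d iP dPt M0 iM Mb).
rewrite -derive1E; exact: (differentiation_under_integral (mu := lebesgue_measure) mT t0d iP dPt M0 iM Mb).
Qed.

(** The integral of an exact derivative in the angular variable vanishes since the
    fiberwise sums have period [2 * pi]. *)
Lemma level_flow_angle mu u v t : holomorphic_on U u -> holomorphic_on U v -> I t ->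
  \int[arc_length R]_(z in level t) flow_pairing 'i%C mu u v z = 0.
Proof.
move=> hu hv It; have cfp := flow_pairing_continuous (lam := 'i%C) (mu := mu) hu hv.
rewrite (level_integral It cfp).
pose P s := fiber_sum U f (density (pairing mu u v)) (polar t s).
have PD (s : R) : is_derive s 1 P (fiber_sum U f (density (flow_pairing 'i%C mu u v)) (polar t s)).
  exact: (@fiber_sum_derive mu 'i%C u v (polar t) t s s hu hv It erefl (polar_derive_angle t s)).
have Pc (s : R) : {for s, continuous P}.
  by apply: differentiable_continuous; apply/derivable1_diffP; have [] := PD s.
have p20 : 0 < pi *+ 2 :> R by rewrite pmulrn_lgt0// pi_gt0.
rewrite /Rintegral (@continuous_FTC2 _ _ P)//.
- have -> : P (pi *+ 2) = P 0 by rewrite /P -[pi *+ 2]add0r polarD2pi.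
  by rewrite subee.
- exact: fiber_sum_within.
- split.
  + by move=> s _; have [] := PD s.
  + by apply: cvg_at_right_filter; exact: Pc.
  + by apply: cvg_at_left_filter; exact: Pc.
- by move=> s _; rewrite derive1E; have [] := PD s.
Qed.

Lemma level_pairing_integrable mu u v t : holomorphic_on U u -> holomorphic_on U v -> I t ->
  (arc_length R).-integrable (level t) (EFin \o pairing mu u v).
Proof. by move=> hu hv It; apply: level_integrable => //; exact: pairing_continuous. Qed.

Lemma level_flow_pairing lam mu u v t : holomorphic_on U u -> holomorphic_on U v -> I t ->
  \int[arc_length R]_(z in level t) flow_pairing lam mu u v z =
  1 / 2 * (level_pairing (mu * lam) (G_op f u) v t + level_pairing (mu * lam^*) u (G_op f v) t).
Proof.
move=> hu hv It.
have mE : measurable (level t : set plane).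
  by apply: closed_measurable_plane; apply: compact_closed_plane; exact: level_compact.
have i1 := level_pairing_integrable (mu * lam) (holomorphic_flow hu) hv It.
have i2 := level_pairing_integrable (mu * lam^*) hu (holomorphic_flow hv) It.
rewrite /flow_pairing RintegralZl//; last exact: (integrableD mE i1 i2).
by rewrite RintegralD.
Qed.

(** The angular derivative of the imaginary part of [h_u * h_v^*] is half the
    difference of the densities of both sides. *)
Lemma level_pairing_adjoint u v t : holomorphic_on U u -> holomorphic_on U v -> I t ->
  level_pairing 1 (G_op f u) v t = level_pairing 1 u (G_op f v) t.
Proof.
move=> hu hv It.
have mE : measurable (level t : set plane).
  by apply: closed_measurable_plane; apply: compact_closed_plane; exact: level_compact.
have := level_flow_pairing 'i%C (- 'i%C) hu hv It.
rewrite (level_flow_angle (- 'i%C) hu hv It).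
have -> : - 'i%C * 'i%C = 1 :> C R by rewrite mulNr -expr2 sqr_i opprK.
have -> : - 'i%C * ('i%C)^* = -1 :> C R.
  by apply: complex_ext; rewrite !ReImE/=; ring.
have -> : level_pairing (-1) u (G_op f v) t = - level_pairing 1 u (G_op f v) t.
  rewrite /level_pairing -[RHS]mulN1r -RintegralZl//.
    apply: eq_Rintegral => z _; rewrite /pairing; move: (G_op f v z) (u z) => a b.
    by rewrite !ReImE/=; ring.
  exact: level_pairing_integrable (holomorphic_flow hv) It.
by lra.
Qed.

(** The two terms of the derivative in [t] have equal integrals by adjointness, and
    each carries the factor [1 / 2]. *)
Lemma level_pairing_derive u v t : holomorphic_on U u -> holomorphic_on U v -> I t ->
  is_derive t 1 (level_pairing 1 u v) (level_pairing 1 (G_op f u) v t).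
Proof.
move=> hu hv It; have := level_pairing_derive_flow 1 hu hv It.
rewrite level_flow_pairing// conjC1 !mulr1 -(level_pairing_adjoint hu hv It).
by move=> D; apply: (is_derive_eq D); lra.
Qed.

End Level_integral.

(** * Lemniscate regions *)

Section Lemniscate_regions.
Context {R : realType}.

Lemma ln_interval_open (a b : \bar R) : open (ln_interval a b).
Proof.
have oa : open [set t : R | (a < t%:E)%E].
  case: a => [a| |].
  - by under eq_set do rewrite lte_fin; exact: open_gt.
  - rewrite (_ : [set _ | _] = set0); first exact: open0.
    by apply/seteqP; split=> t //=; rewrite ltNge leey.
  - rewrite (_ : [set _ | _] = setT); first exact: openT.
    by apply/seteqP; split=> t //= _; rewrite ltNyr.
have ob : open [set t : R | (t%:E < b)%E].
  case: b => [b| |].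
  - by under eq_set do rewrite lte_fin; exact: open_lt.
  - rewrite (_ : [set _ | _] = setT); first exact: openT.
    by apply/seteqP; split=> t //= _; rewrite ltry.
  - rewrite (_ : [set _ | _] = set0); first exact: open0.
    by apply/seteqP; split=> t //=; rewrite ltNge leNye.
rewrite (_ : ln_interval a b = [set t : R | (a < t%:E)%E] `&` [set t : R | (t%:E < b)%E]).
  exact: openI.
by apply/seteqP; split=> t /=; [move=> /andP[]|move=> [h1 h2]; apply/andP].
Qed.

Lemma ln_absE (f : C R -> C R) z : f z != 0 -> ln_abs f z = (ln (cabs (f z)))%:E.
Proof. by move=> fz; rewrite /ln_abs lne_EFin// cabs_gt0. Qed.

Lemma ln_abs0 (f : C R -> C R) z : f z = 0 -> ln_abs f z = -oo%E.
Proof. by move=> fz; rewrite /ln_abs fz cabs0 /= lexx. Qed.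

Lemma ln_abs_levelE (f : C R -> C R) z t : f z != 0 ->
  ln_abs f z = t%:E <-> cabs (f z) = expR t.
Proof.
move=> fz; rewrite ln_absE//; split=> [[<-]|->]; last by rewrite expRK.
by rewrite lnK// posrE cabs_gt0.
Qed.

(** The zeros of [f] do not lie in the band, and [ln (cabs (f z))] is continuous off
    them. *)
Lemma ln_band_open (Omega : set (C R)) (f : C R -> C R) (a b : \bar R) :
  open Omega -> analytic_on Omega f -> open (ln_band Omega f a b).
Proof.
move=> oO /analytic_holomorphic hf; rewrite openE => z [Oz abz].
have fz : f z != 0.
  by apply/eqP => fz; move: abz; rewrite ln_abs0// ltNge leNye.
have nO : \forall y \near z, Omega y by exact: open_nbhs_nbhs.
have fc := holomorphic_continuous hf Oz.
have lc : {for z, continuous (fun y => ln (cabs (f y)))}.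
  apply: (@continuous_comp _ _ _ (fun y => cabs (f y))).
    by apply: (@continuous_comp _ _ _ f); [exact: fc|exact: cabs_continuous].
  by apply: continuous_ln; rewrite cabs_gt0.
have nI : \forall y \near z, ln_interval a b (ln (cabs (f y))).
  apply: lc; apply: open_nbhs_nbhs; split; first exact: ln_interval_open.
  by rewrite /ln_interval /= -ln_absE.
have n0 : \forall y \near z, f y != 0.
  have /cvgCP/(_ (cabs (f z)) _)/wrap[] := fc; first by rewrite cabs_gt0.
  apply: filterS => y; apply: contraTneq => ->.
  by rewrite sub0r cabsN ltxx.
by apply: filterS3 nO nI n0 => y Oy Iy y0; split=> //; rewrite ln_absE.
Qed.

Lemma lemniscate_region_open (Omega U : set (C R)) (f : C R -> C R) (a b : \bar R) :
  lemniscate_region Omega U f a b -> open U.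
Proof.
move=> [oO af _ [z _ ->] _].
by apply: open_connected_component; exact: ln_band_open.
Qed.

Lemma lemniscate_region_sub (Omega U : set (C R)) (f : C R -> C R) (a b : \bar R) :
  lemniscate_region Omega U f a b -> U `<=` Omega.
Proof.
by move=> [_ _ _ [z _ ->] _] y /connected_component_sub[].
Qed.

End Lemniscate_regions.

Section Sums_of_integrals.
Context d (T : measurableType d) (R : realType) (mu : {measure set T -> \bar R}).

Lemma Rintegral_sum (D : set T) (J : Type) (s : seq J) (h : J -> T -> R) : measurable D ->
  (forall i, mu.-integrable D (EFin \o h i)) ->
  mu.-integrable D (EFin \o (fun z => \sum_(i <- s) h i z)) /\
  \int[mu]_(z in D) (\sum_(i <- s) h i z) = \sum_(i <- s) \int[mu]_(z in D) h i z.
Proof.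
move=> mD ih; elim: s => [|i s [IH1 IH2]].
  under [in X in _ /\ X = _]eq_Rintegral do rewrite big_nil.
  rewrite big_nil Rintegral_cst// mul0r; split=> //.
  by under eq_fun do rewrite big_nil; exact: integrable0.
have -> : (fun z => \sum_(j <- i :: s) h j z) = (fun z => h i z + \sum_(j <- s) h j z).
  by apply/funext => z; rewrite big_cons.
split; first exact: (integrableD mD (ih i) IH1).
by rewrite RintegralD// big_cons IH2.
Qed.

End Sums_of_integrals.

Theorem theorem1 (R : realType) (Omega U : set (C R)) (f w : C R -> C R)
    (a b : \bar R)
    (hU : regular_lemniscate_region Omega U f a b)
    (hw : analytic_on U w) :
  let I := ln_interval a b in
  let L := L_fun U f w in
  [/\ smooth_on I L,
      forall t : R, I t -> hamburger_moment_sequence (fun k => derive1n k L t) &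
      forall (k : nat) (t : R), I t -> forall j : nat, (j <= k)%N ->
        (derive1n k L t)%:E =
          level_inner U f t (G_iter f w j) (G_iter f w (k - j))].
Proof.
move=> I L; have [lU ff'] := hU.
have oU := lemniscate_region_open lU.
have f0 z : U z -> f z != 0 by move=> /ff'; apply: contraNneq => ->; rewrite mul0r.
have f'0 z : U z -> derive1 f z != 0.
  by move=> /ff'; apply: contraNneq => ->; rewrite mulr0.
have hf : holomorphic_on U f.
  apply: analytic_holomorphic => z /(lemniscate_region_sub lU).
  by case: lU => _ af _ _ _; exact: af.
have oI : open I := @ln_interval_open R a b.
have proper (K : set R) : compact K -> K `<=` I ->
    compact [set z | U z /\ exists2 t, K t & cabs (f z) = expR t].
  case: lU => _ _ _ _ pU cK KI.
  rewrite (_ : [set _ | _] = \bigcup_(t in K) level_set U f t); first exact: pU.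
  apply/seteqP; split=> z.
    by move=> [Uz [t Kt fz]]; exists t => //; split=> //=; apply/ln_abs_levelE => //; exact: f0.
  move=> [t Kt [Uz /= fz]]; split=> //; exists t => //.
  by apply/ln_abs_levelE => //; exact: f0.
have levelE t : level_set U f t = level U f t.
  apply/seteqP; split=> z [Uz /= fz]; split=> //.
    by apply/ln_abs_levelE => //; exact: f0.
  by rewrite /=; apply/ln_abs_levelE => //; exact: f0.
have hG k : holomorphic_on U (G_iter f w k).
  by apply: holomorphic_G_iter => //; exact: analytic_holomorphic.
pose P i j t := level_pairing U f 1 (G_iter f w i) (G_iter f w j) t.
have LE t : L t = P 0%N 0%N t.
  rewrite /L /L_fun levelE; apply: eq_Rintegral => z _.
  by rewrite /pairing mul1r cabs_sqr !ReImE mulNr opprK !expr2.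
have PS i j t : I t -> P i j t = P (i + j)%N 0%N t.
  move=> It; elim: j i => [|j IH] i; first by rewrite addn0.
  rewrite addnS -addSn -IH.
  rewrite /P /G_iter !iterS; apply/esym.
  exact: (level_pairing_adjoint oU hf f'0 oI proper f0 (hG i) (hG j) It).
have PD k t : I t -> is_derive t 1 (P k 0%N) (P k.+1 0%N t).
  move=> It; rewrite {2}/P /G_iter iterS.
  exact: (level_pairing_derive oU hf f'0 oI proper f0 (hG k) (hG 0%N) It).
have near_I t : I t -> \forall t' \near t, I t' by move=> It; exact: open_nbhs_nbhs.
have derL k t : I t -> derive1n k L t = P k 0%N t.
  elim: k t => [|k IH] t It; first by rewrite derive1n0 LE.
  rewrite derive1nS derive1E (@near_eq_derive _ _ _ _ (P k 0%N)).
    by have [] := PD k t It.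
  by apply: filterS (near_I t It) => t' /IH.
split.
- move=> k t It; have [+ _] := PD k t It; apply: near_eq_derivable.
  by apply: filterS (near_I t It) => t' It'; rewrite derL.
- move=> t It p; split.
    by apply/matrixP => i j; rewrite !mxE addnC.
  move=> x.
  have hE i j : derive1n (i + j)%N L t = P i j t by rewrite derL// -PS.
  rewrite mxE; under eq_bigr do rewrite mxE mulr_suml.
  have mE : measurable (level U f t : set (caratheodory_type (@hausdorff1_outer R))).
    apply: closed_measurable_plane; apply: compact_closed_plane.
    exact: (level_compact proper It).
  pose h (p : 'I_p.+1 * 'I_p.+1) z := x p.2 0 * x p.1 0 *
    pairing 1 (G_iter f w p.2) (G_iter f w p.1) z.
  have ip i j : (arc_length R).-integrable (level U f t)
      (EFin \o pairing 1 (G_iter f w i) (G_iter f w j)).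
    exact: (level_pairing_integrable oU hf f'0 oI proper 1 (hG i) (hG j) It).
  have ih q : (arc_length R).-integrable (level U f t) (EFin \o h q).
    by apply: (integrableZl mE) (ip _ _).
  have [_ sE] := Rintegral_sum (index_enum _) mE ih.
  suff -> : \sum_j \sum_i x^T 0 i * hankel (fun k => derive1n k L t) p i j * x j 0 =
      \int[arc_length R]_(z in level U f t) (\sum_q h q z).
    apply: Rintegral_ge0 => z _; rewrite -(pair_bigA _ (fun j i => h (j, i) z)) /=.
    (* The quadratic form is the squared modulus of the sum of the [x i * w_[i] z]. *)
    pose A := \sum_(i < p.+1) x i 0 * complex.Re (G_iter f w i z).
    pose B := \sum_(i < p.+1) x i 0 * complex.Im (G_iter f w i z).
    rewrite (_ : \sum_j _ = A ^+ 2 + B ^+ 2) ?addr_ge0 ?sqr_ge0//.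
    rewrite !expr2 {1}/A {1}/B !mulr_suml -big_split/=; apply: eq_bigr => j _.
    rewrite /A /B !mulr_sumr -big_split/=; apply: eq_bigr => i _.
    by rewrite /h /pairing mul1r !ReImE/=; ring.
  rewrite sE -(pair_bigA _ (fun j i => \int[arc_length R]_(z in level U f t) h (j, i) z))/=.
  apply: eq_bigr => j _; apply: eq_bigr => i _.
  rewrite !mxE hE /h/= RintegralZl//; first by rewrite /P /level_pairing; ring.
- move=> k t It j jk; rewrite derL// -{1}(subnKC jk) -PS// /P /level_pairing /level_inner levelE.
  rewrite /Rintegral fineK.
    by apply: eq_integral => z _; rewrite /pairing mul1r.
  apply: integrable_fin_num => //.
    apply: closed_measurable_plane; apply: compact_closed_plane.
    exact: (level_compact proper It).
  exact: (level_pairing_integrable oU hf f'0 oI proper 1 (hG j) (hG _) It).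
Qed.
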